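(* Let $\delta\in(0,n]$, $p\in[1,\infty)$, $q\in(0,\infty)$ and $w\in\mathcal A_{p,\delta}$. Then there exist positive constants $c$ and $C$ such that, for any cube $Q$, any $t\in(0,\infty)$ and any $f\in \mathrm{BLO}^q_w(\mathbb R^n,\mathcal H_\infty^\delta)$ with $\|f\|_{\mathrm{BLO}^q_w(\mathbb R^n,\mathcal H_\infty^\delta)}\ne0$, $$w_{\mathcal H_\infty^\delta}\left(\left\{x\in Q:f(x)-\operatorname*{ess\,inf}_{y\in Q}f(y)>t\right\}\right)\le C\,w_{\mathcal H_\infty^\delta}(Q)\,\exp\left(-\frac{ct}{\|f\|_{\mathrm{BLO}^q_w(\mathbb R^n,\mathcal H_\infty^\delta)}}\right).$$
   Context: A cube $Q\subset\mathbb R^n$ is always left-open and right-closed with sides parallel to the coordinate axes; $l(Q)$ is its edge length. For $\delta\in(0,n]$ and $E\subset\mathbb R^n$ the Hausdorff content is $\mathcal H_\infty^\delta(E)=\inf\{\sum_i l(Q_i)^\delta: E\subset\bigcup_iQ_i\}$, the infimum over all finite or countable coverings by cubes. For any (not necessarily measurable) $f\ge0$, the Choquet integral is $\int_E f\,d\mathcal H_\infty^\delta=\int_0^\infty\mathcal H_\infty^\delta(\{x\in E:f(x)>t\})\,dt$. $L^1_{\rm loc}(\mathbb R^n,\mathcal H_\infty^\delta)$ is the set of functions with $\int_K|f|\,d\mathcal H_\infty^\delta<\infty$ for every compact $K$. A weight is a function $w\in L^1_{\rm loc}(\mathbb R^n,\mathcal H_\infty^\delta)$ with $w\in(0,\infty)$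 $\mathcal H_\infty^\delta$-a.e. (i.e. outside a set of content zero). For $p\in(1,\infty)$, $\mathcal A_{p,\delta}$ is the set of weights with $[w]_{\mathcal A_{p,\delta}}=\sup_Q\{\frac1{\mathcal H_\infty^\delta(Q)}\int_Q w\,d\mathcal H_\infty^\delta\}\{\frac1{\mathcal H_\infty^\delta(Q)}\int_Q w^{-\frac1{p-1}}\,d\mathcal H_\infty^\delta\}^{p-1}<\infty$ (supremum over all cubes); $\mathcal A_{1,\delta}$ is the set of weights with $[w]_{\mathcal A_{1,\delta}}=\inf\{c\in(0,\infty):\mathcal M_{\mathcal H_\infty^\delta}w\le c\,w\ \ \mathcal H_\infty^\delta\text{-a.e.}\}<\infty$, where $\mathcal M_{\mathcal H_\infty^\delta}w(x)=\sup_{Q\ni x}\frac1{\mathcal H_\infty^\delta(Q)}\int_Q|w|\,d\mathcal H_\infty^\delta$. $w_{\mathcal H_\infty^\delta}(E)=\int_E w\,d\mathcal H_\infty^\delta$; $L^q_{w,\rm loc}(\mathbb R^n,\mathcal H_\infty^\delta)$ is the set of functions with $\int_K|f|^qw\,d\mathcal H_\infty^\delta<\infty$ for every compact $K$. For real-valued $f$ and a cube $Q$, $\operatorname{ess\,inf}_{y\in Q}f(y)=\inf\{t\in\mathbb R:\mathcal H_\infty^\delta(\{x\in Q:f(x)<t\})>0\}$. $\mathrm{BLO}^q_w(\mathbb R^n,\mathcal H_\infty^\delta)$ is the set of $f\in L^q_{w,\rm loc}(\mathbb R^n,\mathcal H_\infty^\delta)$ with $$\|f\|_{\mathrm{BLO}^q_w(\mathbb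 R^n,\mathcal H_\infty^\delta)}=\sup_Q\left[\frac1{w_{\mathcal H_\infty^\delta}(Q)}\int_Q\left|f(x)-\operatorname*{ess\,inf}_{y\in Q}f(y)\right|^qw(x)\,d\mathcal H_\infty^\delta\right]^{1/q}<\infty,$$ the supremum over all cubes (infinite if some essential infimum is $-\infty$). *)

(* Defs.v *)
From HB Require Import structures.
From mathcomp Require Import all_boot all_order all_algebra.
From mathcomp Require Import all_classical all_reals all_analysis.

Set Implicit Arguments.
Unset Strict Implicit.
Unset Printing Implicit Defensive.

Import Order.TTheory GRing.Theory Num.Theory.
Import numFieldNormedType.Exports.

Local Open Scope classical_set_scope.
Local Open Scope ring_scope.
Local Open Scope ereal_scope.

Record cube (R : realType) (n : nat) := Cube {
  corner : 'rV[R]_n;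
  edge : R;
  edge_gt0 : (0 < edge)%R
}.

Section HausdorffContent.
Context {R : realType} {n : nat}.
Implicit Types (E K : set 'rV[R]_n) (Q : cube R n).

Definition cube_set Q : set 'rV[R]_n :=
  [set x | forall i : 'I_n,
     (corner Q ord0 i < x ord0 i <= corner Q ord0 i + edge Q)%R].

(* [D] is the index set of the covering: both finite and countably infinite
   coverings are admitted. *)
Definition hcontent (delta : R) E : \bar R :=
  ereal_inf [set s | exists (D : set nat) (Q : nat -> cube R n),
    E `<=` \bigcup_(i in D) cube_set (Q i) /\
    s = \esum_(i in D) ((edge (Q i)) `^ delta)%:E].

Definition hcontent_ae (delta : R) (P : 'rV[R]_n -> Prop) : Prop :=
  hcontent delta [set x | ~ P x] = 0.

Definition choquet (delta : R) E (f : 'rV[R]_n -> \bar R) : \bar R :=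
  \int[lebesgue_measure]_(t in `]0%R, +oo[)
    hcontent delta (E `&` [set x | t%:E < f x]).

Definition choquet_avg (delta : R) Q (f : 'rV[R]_n -> \bar R) : \bar R :=
  (hcontent delta (cube_set Q))^-1 * choquet delta (cube_set Q) f.

Definition L1loc (delta : R) (f : 'rV[R]_n -> \bar R) : Prop :=
  forall K, compact K -> choquet delta K (fun x => `|f x|) < +oo.

Definition weight (delta : R) (w : 'rV[R]_n -> \bar R) : Prop :=
  L1loc delta w /\ hcontent_ae delta (fun x => 0 < w x < +oo).

(* [w^(-1/(p-1))] is written as the inverse of [w^(1/(p-1))]: the inverse on
   [\bar R] exchanges [0] and [+oo], whereas [poweR] with a negative exponent
   maps [0] to [0] and [+oo] to [+oo]. *)
Definition Ap_const (delta p : R) (w : 'rV[R]_n -> \bar R) : \bar R :=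
  ereal_sup [set choquet_avg delta Q w *
      (choquet_avg delta Q (fun x => (w x `^ (p - 1)^-1)^-1)) `^ (p - 1)
    | Q in [set: cube R n]].

Definition maximal (delta : R) (w : 'rV[R]_n -> \bar R) (x : 'rV[R]_n) :
    \bar R :=
  ereal_sup [set choquet_avg delta Q (fun y => `|w y|)
    | Q in [set Q : cube R n | cube_set Q x]].

Definition A1_const (delta : R) (w : 'rV[R]_n -> \bar R) : \bar R :=
  ereal_inf [set c%:E | c in [set c : R | (0 < c)%R /\
    hcontent_ae delta (fun x => maximal delta w x <= c%:E * w x)]].

Definition muckenhoupt (delta p : R) (w : 'rV[R]_n -> \bar R) : Prop :=
  weight delta w /\
  (if p == 1%R then A1_const delta w else Ap_const delta p w) < +oo.

Definition Lqwloc (delta q : R) (w : 'rV[R]_n -> \bar R) (f : 'rV[R]_n -> R) :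
    Prop :=
  forall K, compact K ->
    choquet delta K (fun x => (`|f x| `^ q)%:E * w x) < +oo.

Definition essinf (delta : R) Q (f : 'rV[R]_n -> R) : \bar R :=
  ereal_inf [set t%:E | t in [set t : R |
    0 < hcontent delta (cube_set Q `&` [set x | (f x < t)%R])]].

(* If the essential infimum over [Q] is [-oo], the integrand is [+oo] wherever
   [w] is positive, so for a weight the norm is [+oo]. *)
Definition BLO_norm (delta q : R) (w : 'rV[R]_n -> \bar R)
    (f : 'rV[R]_n -> R) : \bar R :=
  ereal_sup [set
    ((choquet delta (cube_set Q) w)^-1 *
     choquet delta (cube_set Q)
       (fun x => `|(f x)%:E - essinf delta Q f| `^ q * w x)) `^ q^-1
    | Q in [set: cube R n]].

Definition BLO (delta q : R) (w : 'rV[R]_n -> \bar R) (f : 'rV[R]_n -> R) :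
    Prop :=
  Lqwloc delta q w f /\ BLO_norm delta q w f < +oo.

End HausdorffContent.

(* Main.v *)
Require Import Defs.
From HB Require Import structures.
From mathcomp Require Import all_boot all_order all_algebra.
From mathcomp Require Import all_classical all_reals all_analysis.
From mathcomp Require Import measurable_realfun.
From mathcomp Require Import ring lra.

(* Write w(E) for the Choquet integral of w over E and m_Q for the essential
   infimum of f over a cube Q.  Neither w nor the content is additive, so the
   classical stopping-time argument is replaced by an optimal dyadic covering.

   The A_p (or A_1) condition enters only through Chebyshev's inequality: a part
   of Q of content at least a fixed fraction of that of Q carries at least a
   fixed fraction of w(Q).  Choose A to be a large multiple of the BLO norm, so
   that every {x in P : f > m_P + A} has small weight, hence small content, in P.

   Fix Q, put G = {x in Q : f > m_Q + A}, and select the maximal dyadic subcubes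
   P of Q which are a cheapest dyadic covering of their own trace G cap P.  By
   optimality the selected cubes are packed (inside any dyadic cube their costs
   add up to at most its cost), and packing makes the content, hence w, additive
   on them up to a constant; so the sum of w(P) is at most C w(G), a small part
   of w(Q).  A cube P contained in no selected cube is not essentially covered
   by G, so m_P <= m_Q + A; passing to the parent, m_P <= m_Q + 2A on the selected
   cubes.  The set where f > m_Q + 2A outside the selected cubes has density at
   most gamma in every dyadic cube, so its content is at most a half of itself,
   that is 0: this replaces Lebesgue's differentiation theorem.  Hence raising
   the level by 2A halves the weight, and iteration gives the exponential. *)

Set Implicit Arguments.
Unset Strict Implicit.
Unset Printing Implicit Defensive.

Import Order.TTheory GRing.Theory Num.Theory.
Import numFieldNormedType.Exports.

Local Open Scope classical_set_scope.
Local Open Scope ring_scope.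
Local Open Scope ereal_scope.

(** * Sums of nonnegative families over arbitrary index sets *)

Section EsumComplements.
Context {R : realType}.

Lemma esum_subset (T : choiceType) (A B : set T) (a : T -> \bar R) :
  A `<=` B -> \esum_(i in A) a i <= \esum_(i in B) a i.
Proof.
move=> AB; apply: le_ereal_sup => _ [X [finX XA] <-].
by exists X => //; split => // x /XA /AB.
Qed.

Lemma esum_pZl (T : choiceType) (A : set T) (a : T -> \bar R) (c : R) :
  (0 < c)%R -> (forall i, 0 <= a i) ->
  \esum_(i in A) (c%:E * a i) = c%:E * \esum_(i in A) a i.
Proof.
move=> c0 a0; rewrite /esum -ereal_sup_pZl//; congr ereal_sup.
apply/seteqP; split=> [_ [X XA <-]|_ [_ [X XA <-] <-]] /=.
  exists (\sum_(i \in X) a i); first by exists X.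
  by rewrite !fsbig_finite ?ge0_sume_distrr//; case: XA.
by exists X => //; rewrite !fsbig_finite ?ge0_sume_distrr//; case: XA.
Qed.

(** The sets [B i] may overlap. Each point of the union is assigned one index by [g], and the graph
    of this choice is a subset of the disjoint union. *)
Lemma esum_bigcup_le (I T : choiceType) (D : set I) (B : I -> set T)
    (a : T -> \bar R) : (forall x, 0 <= a x) ->
  \esum_(x in \bigcup_(i in D) B i) a x <= \esum_(i in D) \esum_(x in B i) a x.
Proof.
move=> a0; rewrite esum_esum//.
have /choice[g gP] : forall x, exists i : option I,
    (\bigcup_(i in D) B i) x -> exists2 j, i = Some j & D j /\ B j x.
  move=> x; have [[i Di Bix]|nx] := pselect ((\bigcup_(i in D) B i) x).
    by exists (Some i) => _; exists i.
  by exists None => /nx.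
pose P := [set k : I * T | (\bigcup_(i in D) B i) k.2 /\ g k.2 = Some k.1].
rewrite (reindex_esum P _ snd); last split=> //.
- apply: esum_subset => -[i x] [/= /gP[j -> [Dj Bj]] [<-]]//.
- by move=> [i x] [].
- move=> [i x] [j y]; rewrite !inE => -[/= _ gx] [/= _ gy] xy.
  by move: gx; rewrite xy gy => -[->].
- by move=> x Bx; have [j gx Dj] := gP _ Bx; exists (j, x).
Qed.

Lemma esum_exchange (I T : choiceType) (A : set I) (B : set T)
    (a : I -> T -> \bar R) : (forall i x, 0 <= a i x) ->
  \esum_(i in A) \esum_(x in B) a i x = \esum_(x in B) \esum_(i in A) a i x.
Proof.
move=> a0; rewrite (esum_esum (J := fun=> B))// (esum_esum (J := fun=> A))//.
rewrite (reindex_esum (B `*` A) (A `*` B) (fun x => (x.2, x.1)))//; split=> //=.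
- by move=> [i j] [/=].
- by move=> [i1 i2] [j1 j2] /= _ _ [] -> ->.
- by move=> [i1 i2] [Pi1 Qi2] /=; exists (i2, i1).
Qed.

(** Rewriting the sum as a series gives access to countable subadditivity along [nat] and to
    termwise integration of series. *)
Lemma esum_countable (T : countType) (A : set T) (a : T -> \bar R) :
  (forall i, 0 <= a i) ->
  \esum_(i in A) a i =
  \sum_(k <oo) (if pickle_inv k is Some i then if i \in A then a i else 0 else 0).
Proof.
move=> a0; rewrite nneseries_esumT; last first.
  by move=> k; case: pickle_inv => // i; case: ifP.
rewrite [in LHS]esum_mkcond; set b := fun k : nat => _.
have -> : \esum_(i in [set: T]) (if i \in A then a i else 0) =
    \esum_(i in [set: T]) b (pickle i).
  by apply: eq_esum => i _; rewrite /b pickleK_inv.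
rewrite -(esum_image setT (@pickle T)); last first.
  by move=> x y _ _ /(pcan_inj pickleK_inv).
rewrite esum_mkcond; apply: eq_esum => k _; rewrite /b; case: ifPn => //.
rewrite notin_setE => /= nk; have := @pickle_invK T k.
by case: pickle_inv => //= i ik; case: nk; exists i.
Qed.

End EsumComplements.

(** * Hausdorff content *)

Section Content.
Context {R : realType} {n : nat} (delta : R).
Implicit Types (E F : set 'rV[R]_n) (Q : cube R n).
Local Notation H := (@hcontent R n delta).

Definition cost Q : \bar R := ((edge Q) `^ delta)%:E.

Lemma cost_ge0 Q : 0 <= cost Q.
Proof. by rewrite lee_fin powR_ge0. Qed.

Lemma cost_gt0 Q : 0 < cost Q.
Proof. by rewrite lte_fin powR_gt0 // edge_gt0. Qed.

Lemma hcontent_ge0 E : 0 <= H E.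
Proof.
apply: le_ereal_inf_tmp => _ [D [Q [_ ->]]].
by apply: esum_ge0 => i _; exact: cost_ge0.
Qed.

Lemma le_hcontent E F : E `<=` F -> H E <= H F.
Proof.
move=> EF; apply: ereal_inf_le_tmp => _ [D [Q [FQ ->]]].
by exists D, Q; split => //; exact: subset_trans FQ.
Qed.

Lemma hcontent_le_cover (I : countType) (D : set I) (Q : I -> cube R n) E :
  E `<=` \bigcup_(i in D) cube_set (Q i) -> H E <= \esum_(i in D) cost (Q i).
Proof.
(* The default cube [Q0] costs nothing: the covering is indexed by the image of [pickle] only. *)
move=> EQ; pose Q0 : cube R n := Cube 0 (@ltr01 R).
pose Q' k := if unpickle k is Some i then Q i else Q0.
apply: ge_ereal_inf; exists (\esum_(k in pickle @` D) cost (Q' k)).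
  exists (pickle @` D), Q'; split => // x /EQ[i Di Qix].
  by exists (pickle i); [exists i|rewrite /Q' pickleK].
rewrite esum_image; last by move=> i j _ _ /(pcan_inj pickleK).
by apply: le_esum => i _; rewrite /Q' pickleK.
Qed.

Lemma hcontent_lt E x : H E < x -> exists (D : set nat) (Q : nat -> cube R n),
  E `<=` \bigcup_(i in D) cube_set (Q i) /\ \esum_(i in D) cost (Q i) < x.
Proof. by move=> /ereal_inf_lt[_ [D [Q [EQ ->]]] lx]; exists D, Q. Qed.

Lemma hcontent_cube_le Q : H (cube_set Q) <= cost Q.
Proof.
have := @hcontent_le_cover nat [set 0%N] (fun=> Q) (cube_set Q).
by rewrite esum_set1 ?cost_ge0//; apply; rewrite bigcup_set1.
Qed.

Lemma hcontent0 : H set0 = 0.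
Proof.
apply/eqP; rewrite eq_le hcontent_ge0 andbT.
by rewrite -(esum_set0 (fun k : nat => cost (Cube 0 (@ltr01 R) : cube R n)))
  hcontent_le_cover.
Qed.

Lemma hcontent_bigcup_nat (F : nat -> set 'rV[R]_n) :
  H (\bigcup_k F k) <= \sum_(k <oo) H (F k).
Proof.
(* An infinite term makes the bound trivial. If all terms are finite, coverings optimal up to e /
   2^(k+1) are merged. *)
have [[k Fk]|nF] := pselect (exists k, H (F k) = +oo).
  rewrite (_ : \sum_(k <oo) _ = +oo) ?leey// nneseries_esumT; last first.
    by move=> *; exact: hcontent_ge0.
  apply/eqP; rewrite -leye_eq -Fk.
  have := @esum_subset R _ [set k] setT (fun k => H (F k)) (@subsetT _ _).
  by rewrite esum_set1// hcontent_ge0.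
have fF k : H (F k) \is a fin_num.
  rewrite ge0_fin_numE ?hcontent_ge0// ltey; apply/eqP => Fk.
  by apply: nF; exists k.
apply/lee_addgt0Pr => e e0.
apply: le_trans (epsilon_trick xpredT (fun k => hcontent_ge0 (F k)) (ltW e0)).
have /choice[DQ DQP] k : exists DQ : set nat * (nat -> cube R n),
    F k `<=` \bigcup_(i in DQ.1) cube_set (DQ.2 i) /\
    \esum_(i in DQ.1) cost (DQ.2 i) <= H (F k) + (e / (2 ^ k.+1)%:R)%:E.
  have : H (F k) < H (F k) + (e / (2 ^ k.+1)%:R)%:E.
    by rewrite lteDl// lte_fin divr_gt0// ltr0n expn_gt0.
  by move=> /hcontent_lt[D [Q [FQ /ltW lQ]]]; exists (D, Q).
rewrite nneseries_esumT; last first.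
  by move=> k; rewrite adde_ge0 ?hcontent_ge0// lee_fin divr_ge0 ?ltW.
apply: (@le_trans _ _ (\esum_(k in [set: nat]) \esum_(i in (DQ k).1) cost ((DQ k).2 i))).
  rewrite esum_esum; last by move=> *; exact: cost_ge0.
  apply: (@hcontent_le_cover (nat * nat)%type _ (fun k => (DQ k.1).2 k.2)).
  move=> x [k _ /(DQP k).1[i Di Qx]]; by exists (k, i).
by apply: le_esum => k _; exact: (DQP k).2.
Qed.

Lemma hcontent_bigcup (I : countType) (D : set I) (F : I -> set 'rV[R]_n) :
  H (\bigcup_(i in D) F i) <= \esum_(i in D) H (F i).
Proof.
rewrite esum_countable; last by move=> *; exact: hcontent_ge0.
pose G k := if pickle_inv k is Some i then
  if i \in D then F i else set0 else set0.
apply: (@le_trans _ _ (H (\bigcup_k G k))).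
  apply: le_hcontent => x [i Di Fx]; exists (pickle i) => //.
  by rewrite /G pickleK_inv mem_set.
apply: (le_trans (hcontent_bigcup_nat G)); apply: lee_nneseries => [*|k _].
  exact: hcontent_ge0.
by rewrite /G; case: pickle_inv => [i|]; [case: ifP|]; rewrite ?hcontent0.
Qed.

Lemma hcontentU E F : H (E `|` F) <= H E + H F.
Proof.
pose G b := if b then E else F.
have := @hcontent_bigcup bool setT G.
rewrite (_ : \bigcup_(b in _) _ = E `|` F); last first.
  apply/seteqP; split=> [x [[|] _ Gx]|x [Ex|Fx]]; [by left|by right| |].
    by exists true.
  by exists false.
rewrite (esumID [set true]); last by move=> *; exact: hcontent_ge0.
rewrite setTI (_ : _ `&` _ = [set false]); last first.
  by apply/seteqP; split=> [[|] [_ /= nb]|_ ->] //; split.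
by rewrite !esum_set1 ?hcontent_ge0.
Qed.

Lemma hcontent_null_sub E F : E `<=` F -> H F = 0 -> H E = 0.
Proof.
by move=> EF F0; apply/eqP; rewrite eq_le hcontent_ge0 andbT -F0 le_hcontent.
Qed.

End Content.

(** * Scaling of the content and its value on cubes *)

Section Scaling.
Context {R : realType} {n : nat} (delta : R).
Implicit Types Q : cube R n.
Local Notation H := (@hcontent R n delta).

(** The homothety of ratio [r] carrying [Q] onto [Q'] maps coverings by cubes to coverings by cubes
    and multiplies every cost by r^delta. *)
Lemma hcontent_scale Q Q' :
  H (cube_set Q') <= ((edge Q' / edge Q) `^ delta)%:E * H (cube_set Q).
Proof.
set r := (edge Q' / edge Q)%R.
have r0 : (0 < r)%R by rewrite divr_gt0 ?edge_gt0.
have rd0 : (0 < r `^ delta)%R by rewrite powR_gt0.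
rewrite -lee_pdivrMl//; apply: le_ereal_inf_tmp => _ [D [S [QS ->]]].
rewrite lee_pdivrMl// -esum_pZl//; last by move=> i; exact: cost_ge0.
have rS0 i : (0 < r * edge (S i))%R by rewrite mulr_gt0 ?edge_gt0.
pose S' i := Cube (corner Q' + r *: (corner (S i) - corner Q))%R (rS0 i).
have SE i : (r `^ delta)%:E * (edge (S i) `^ delta)%:E = cost delta (S' i).
  by rewrite /cost /= powRM ?ltW ?edge_gt0.
under eq_esum do rewrite SE.
apply: hcontent_le_cover => x Q'x.
pose y := (corner Q + r^-1 *: (x - corner Q'))%R.
have [j|i Di Sy] := QS y.
  move: (Q'x j) => /andP[cx xc]; rewrite !mxE ltrDl lerD2l.
  rewrite mulr_gt0 ?invr_gt0 ?subr_gt0//= ler_pdivrMl//.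
  by rewrite /r divfK ?gt_eqF ?edge_gt0// lerBlDl.
exists i => // j; move: (Sy j); rewrite /S' /y/= !mxE => /andP[cy yc].
have -> : (x ord0 j = corner Q' ord0 j +
  r * (corner Q ord0 j + r^-1 * (x ord0 j - corner Q' ord0 j) - corner Q ord0 j))%R.
  by rewrite addrAC subrr add0r mulrA divff ?gt_eqF// mul1r addrC subrK.
rewrite ltrD2l ltr_pM2l// ltrD2r cy /=.
by rewrite -[leRHS]addrA lerD2l -mulrDr ler_pM2l// [leRHS]addrAC lerD2r.
Qed.

(** Scaling in both directions between [Q] and the unit cube gives equality; [k] is the content of
    the unit cube. *)
Lemma hcontent_cubeE : exists k : R, (0 <= k <= 1)%R /\
  forall Q, H (cube_set Q) = k%:E * cost delta Q.
Proof.
pose Q0 : cube R n := Cube 0 (@ltr01 R).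
have H1 : H (cube_set Q0) <= 1.
  by apply: le_trans (hcontent_cube_le _ _) _; rewrite /cost powR1.
have Hf : H (cube_set Q0) \is a fin_num.
  by rewrite ge0_fin_numE ?hcontent_ge0// (le_lt_trans H1)// ltry.
exists (fine (H (cube_set Q0))); split.
  by rewrite -!lee_fin fineK// H1 hcontent_ge0.
move=> Q; rewrite fineK//; apply/eqP; rewrite eq_le; apply/andP; split.
  by have := hcontent_scale Q0 Q; rewrite /= divr1 muleC.
have := hcontent_scale Q Q0; rewrite /= mul1r => HQ.
rewrite muleC -lee_pdivlMl ?powR_gt0 ?edge_gt0//.
rewrite -powRN -mulN1r powRrM powR_inv1 //; exact/ltW/edge_gt0.
Qed.
End Scaling.

(** * Dyadic subcubes, addressed by words *)

Section Dyadic.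
Context {R : realType} {n : nat}.
Implicit Types (Q : cube R n) (x : 'rV[R]_n).
Local Notation digit := {ffun 'I_n -> bool}.
Implicit Types (s d : seq digit).

Lemma half_edge_gt0 Q : (0 < edge Q / 2)%R.
Proof. by rewrite divr_gt0 ?edge_gt0. Qed.

Definition child Q (b : digit) : cube R n :=
  Cube (corner Q + \row_i (if b i then edge Q / 2 else 0))%R (half_edge_gt0 Q).

Definition subcube Q s := foldl child Q s.

Lemma subcube_rcons Q s b : subcube Q (rcons s b) = child (subcube Q s) b.
Proof. by rewrite /subcube foldl_rcons. Qed.

Definition child_digit Q x : digit :=
  [ffun i => (corner Q ord0 i + edge Q / 2 < x ord0 i)%R].

(** Left-open, right-closed edges make the children a true partition, so a point of [Q] determines
    its digit. *)
Lemma childP Q b x :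
  cube_set (child Q b) x <-> cube_set Q x /\ b = child_digit Q x.
Proof.
have e0 := edge_gt0 Q.
split=> [Qx|[Qx ->] i]; last first.
  move: (Qx i) => /andP[Qi iQ]; rewrite /= !mxE ffunE.
  by case: (ltP (corner Q ord0 i + edge Q / 2)%R) => ?; apply/andP; split; lra.
split=> [i|].
  by move: (Qx i); rewrite /= !mxE; case: (b i) => /andP[? ?]; apply/andP; split; lra.
apply/ffunP => i; move: (Qx i); rewrite ffunE /= !mxE.
by case: (b i) => /andP[? ?]; apply/esym; [|apply/negbTE; rewrite -leNgt]; lra.
Qed.

Fixpoint address Q x k : seq digit :=
  if k is k'.+1 then
    rcons (address Q x k') (child_digit (subcube Q (address Q x k')) x)
  else [::].

Lemma size_address Q x k : size (address Q x k) = k.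
Proof. by elim: k => //= k IH; rewrite size_rcons IH. Qed.

(** Inside [Q], membership in a cell becomes an equality of words, which turns the nesting of dyadic
    cubes into combinatorics of prefixes. *)
Lemma subcubeP Q s x :
  cube_set (subcube Q s) x <-> cube_set Q x /\ s = address Q x (size s).
Proof.
elim/last_ind: s => [|s b IH]; first by split=> [|[]].
rewrite subcube_rcons size_rcons /=; split.
  by move=> /childP[/IH[Qx sE] ->]; split => //; rewrite -sE.
move=> [Qx] /rcons_inj[sE bE]; apply/childP; split; first exact/IH.
by rewrite bE -sE.
Qed.

Lemma subcube_address Q x k : cube_set Q x ->
  cube_set (subcube Q (address Q x k)) x.
Proof. by move=> Qx; apply/subcubeP; rewrite size_address. Qed.

Lemma take_address Q x k m : (k <= m)%N ->
  take k (address Q x m) = address Q x k.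
Proof.
elim: m => [|m IH]; first by rewrite leqn0 => /eqP ->.
rewrite leq_eqVlt => /predU1P[->|km] /=.
  by rewrite take_oversize// size_rcons size_address.
by rewrite ltnS in km; rewrite -cats1 takel_cat ?size_address// IH.
Qed.

Lemma prefix_subcube Q s d : prefix s d ->
  cube_set (subcube Q d) `<=` cube_set (subcube Q s).
Proof.
move=> /prefixP[u ->] x /subcubeP[Qx sE]; apply/subcubeP; split => //.
by rewrite -(@take_address _ _ _ (size (s ++ u))) -?sE ?take_size_cat// size_cat leq_addr.
Qed.

Lemma subcube_comparable Q s d x : cube_set (subcube Q s) x ->
  cube_set (subcube Q d) x -> prefix s d || prefix d s.
Proof.
move=> /subcubeP[_ sE] /subcubeP[_ dE].
rewrite !prefixE; case: (leqP (size s) (size d)) => sd.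
  by rewrite [X in take _ X]dE take_address// -sE eqxx.
by rewrite [X in _ || (take _ X == _)]sE (take_address _ _ (ltnW sd)) -dE eqxx orbT.
Qed.

Lemma edge_subcube Q s : edge (subcube Q s) = (edge Q / 2 ^+ size s)%R.
Proof.
elim/last_ind: s => [|s b IH]; first by rewrite expr0 divr1.
by rewrite subcube_rcons size_rcons /= IH exprSr invfM mulrA.
Qed.

Lemma cost_prefix (delta : R) Q s d : (0 <= delta)%R -> prefix s d ->
  cost delta (subcube Q d) <= cost delta (subcube Q s).
Proof.
move=> d0 /size_prefix sd; rewrite lee_fin; apply: ge0_ler_powR => //.
- by rewrite nnegrE ltW// edge_gt0.
- by rewrite nnegrE ltW// edge_gt0.
rewrite !edge_subcube ler_pM2l ?edge_gt0// lef_pV2 ?posrE ?exprn_gt0//.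
by rewrite ler_eXn2l// ltr1n.
Qed.

End Dyadic.

(** * The content obtained from dyadic coverings *)

Lemma esum_ge_term {R : realType} (T : choiceType) (A : set T)
    (a : T -> \bar R) i : (forall j, 0 <= a j) -> A i -> a i <= \esum_(j in A) a j.
Proof.
by move=> a0 Ai; rewrite -[leLHS](esum_set1 (a0 i)); apply: esum_subset => _ ->.
Qed.

Lemma prefix_rcons_inv (T : eqType) (s d : seq T) b :
  prefix d (rcons s b) -> d = rcons s b \/ prefix d s.
Proof.
move=> /prefixP[u]; case/lastP: u => [|u c]; first by rewrite cats0; left.
by rewrite -rcons_cat => /rcons_inj[-> _]; right; exact: prefix_prefix.
Qed.

Section DyadicContent.
Context {R : realType} {n : nat} (delta : R) (Q : cube R n).
Hypothesis delta_ge0 : (0 <= delta)%R.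
Implicit Types (E F G : set 'rV[R]_n).
Local Notation digit := {ffun 'I_n -> bool}.
Implicit Types (s d : seq digit) (D : set (seq digit)).
Local Notation H := (@hcontent R n delta).
Local Notation cell s := (cube_set (subcube Q s)).
Local Notation om s := (cost delta (subcube Q s)).

Definition dyadic_content E : \bar R :=
  ereal_inf [set r | exists D : set (seq digit),
    E `<=` \bigcup_(s in D) cell s /\ r = \esum_(s in D) om s].

Lemma dyadic_content_ge0 E : 0 <= dyadic_content E.
Proof.
apply: le_ereal_inf_tmp => _ [D [_ ->]].
by apply: esum_ge0 => i _; exact: cost_ge0.
Qed.

Lemma dyadic_content_le_cover D E :
  E `<=` \bigcup_(s in D) cell s -> dyadic_content E <= \esum_(s in D) om s.
Proof. by move=> ED; apply: ereal_inf_lbound; exists D. Qed.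

(** Take the least [k] satisfying the second inequality. Its failure at the previous generation
    gives the first one; for [k] = 0 the first is the hypothesis. *)
Lemma dyadic_scale (S : cube R n) : (edge S <= edge Q)%R ->
  exists k, (edge S <= edge Q / 2 ^+ k)%R && (edge Q / 2 ^+ k <= 2 * edge S)%R.
Proof.
move=> SQ; have S0 := edge_gt0 S; have Q0 := edge_gt0 Q.
have exk : exists k, (edge Q / 2 ^+ k <= 2 * edge S)%R.
  have := archi_boundP (divr_ge0 (ltW Q0) (ltW S0)).
  set m := Num.bound _ => Qm; exists m.
  rewrite ler_pdivrMr ?exprn_gt0// mulrAC -ler_pdivrMr//.
  apply: (le_trans (ltW Qm)); rewrite -[leLHS]mul1r ler_pM// ?ler1n//.
  by rewrite -natrX ler_nat ltnW// ltn_expl.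
case: (ex_minnP exk) => -[|k] km min; first by exists 0%N; rewrite km expr0 divr1 SQ.
exists k.+1; rewrite km andbT leNgt; apply/negP => kS.
suff : (edge Q / 2 ^+ k <= 2 * edge S)%R by move=> /min; rewrite ltnn.
by move: kS; rewrite exprS invfM mulrCA ltr_pdivrMl// => /ltW.
Qed.

(* A cell of edge at least that of [S] which meets [S] contains a vertex of [S],
   so at most [2 ^ n] cells of a given generation are needed to cover it. *)
Lemma dyadic_cover (S : cube R n) : exists D,
  cube_set S `&` cube_set Q `<=` \bigcup_(s in D) cell s /\
  \esum_(s in D) om s <= (#|{: digit}|%:R * 2 `^ delta)%:E * cost delta S.
Proof.
have S0 := edge_gt0 S; have Q0 := edge_gt0 Q.
have N1 : (1 <= #|{: digit}|%:R :> R)%R by rewrite ler1n; apply/card_gt0P; exists [ffun=> true].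
have [QS|SQ] := ltP (edge Q) (edge S).
  exists [set [::]]; split; first by rewrite bigcup_set1; exact: subIsetr.
  rewrite esum_set1 ?cost_ge0//; apply: (@le_trans _ _ (cost delta S)).
    by rewrite lee_fin; apply: ge0_ler_powR; rewrite ?nnegrE ?(ltW Q0) ?(ltW S0) ?(ltW QS).
  rewrite lee_fin ler_peMl ?powR_ge0// -[leLHS]mulr1 ler_pM//.
  by rewrite -[leLHS](powRr0 2) ler_powR// ler1n.
have [k /andP[Sk kS]] := dyadic_scale SQ.
pose v (b : digit) := (corner S + \row_i (if b i then edge S else 0))%R.
pose B := \bigcup_(b in [set: digit]) [set address Q (v b) k].
exists B; split.
  move=> x [Sx Qx]; pose s := address Q x k.
  have sx : cell s x by exact: subcube_address.
  have es : edge (subcube Q s) = (edge Q / 2 ^+ k)%R.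
    by rewrite edge_subcube size_address.
  (* In each coordinate, if [S] starts no later than the cell, the upper end of [S] lies in the
     cell's range; otherwise the lower end does. *)
  pose b : digit := [ffun i => (corner S ord0 i <= corner (subcube Q s) ord0 i)%R].
  have vs : cell s (v b).
    move=> i; move: (Sx i) (sx i) => /andP[? ?] /andP[? ?]; rewrite /v !mxE ffunE.
    by case: (leP (corner S ord0 i)) => ?; apply/andP; split; lra.
  exists s => //; exists b => //=; have /subcubeP[_ sE] := vs.
  by rewrite sE size_address.
apply: le_trans (esum_bigcup_le _ _ _) _; first by move=> *; exact: cost_ge0.
apply: (@le_trans _ _ (\esum_(b in [set: digit]) (2 `^ delta)%:E * cost delta S)).
  apply: le_esum => b _; rewrite esum_set1 ?cost_ge0// -EFinM lee_fin.
  rewrite -powRM ?(ltW S0)//; apply: ge0_ler_powR; rewrite ?nnegrE ?edge_subcube ?size_address//.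
    by rewrite divr_ge0 ?(ltW Q0)// exprn_ge0.
  by rewrite mulr_ge0 ?(ltW S0).
rewrite esum_fset; last 2 first.
- exact: finite_finset.
- by move=> i _; rewrite mule_ge0 ?cost_ge0 ?lee_fin ?powR_ge0.
rewrite (_ : [set: digit] = [set` enum digit]); last first.
  by apply/seteqP; split => // b _ /=; rewrite mem_enum.
rewrite -fsbig_seq ?enum_uniq// big_enum/=.
by rewrite /cost -!EFinM sumEFin sumr_const lee_fin -mulrA mulr_natl.
Qed.

Lemma dyadic_content_le E : E `<=` cube_set Q ->
  dyadic_content E <= (#|{: digit}|%:R * 2 `^ delta)%:E * H E.
Proof.
move=> EQ; have K0 : (0 < #|{: digit}|%:R * 2 `^ delta :> R)%R.
  by rewrite mulr_gt0 ?powR_gt0// ltr0n; apply/card_gt0P; exists [ffun=> true].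
rewrite -lee_pdivrMl//; apply: le_ereal_inf_tmp => _ [I [S [ES ->]]].
rewrite lee_pdivrMl// -esum_pZl//; last by move=> *; exact: cost_ge0.
have /choice[B BP] i := dyadic_cover (S i).
apply: le_trans (dyadic_content_le_cover (D := \bigcup_(i in I) B i) _) _.
  move=> x Ex; have [i Ii Sx] := ES _ Ex.
  have [s Bs sx] := (BP i).1 x (conj Sx (EQ _ Ex)).
  by exists s => //; exists i.
apply: le_trans (esum_bigcup_le _ _ _) _; first by move=> *; exact: cost_ge0.
by apply: le_esum => i _; exact: (BP i).2.
Qed.

(** A covering cheaper than the cell [s] cannot use [s] or an ancestor of it. Each of its cubes that
    meets [s] then lies in a single child, so the covering splits among the children. *)
Lemma dyadic_content_children G s :
  dyadic_content (G `&` cell s) < om s ->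
  \esum_(b in [set: digit]) dyadic_content (G `&` cell (rcons s b)) <=
  dyadic_content (G `&` cell s).
Proof.
move=> light; rewrite leNgt; apply/negP => lts.
have /ereal_inf_lt[_ [D [GD ->]]] :
    dyadic_content (G `&` cell s) < mine (om s)
    (\esum_(b in [set: digit]) dyadic_content (G `&` cell (rcons s b))).
  by rewrite lt_min light lts.
rewrite lt_min => /andP[Ds]; apply/negP; rewrite -leNgt.
have nD d : D d -> ~~ prefix d s.
  move=> Dd; apply/negP => ds; move: Ds; apply/negP; rewrite -leNgt.
  apply: le_trans (cost_prefix _ delta_ge0 ds) _.
  by apply: esum_ge_term Dd => j; exact: cost_ge0.
pose Db b := [set d | D d /\ prefix (rcons s b) d].
apply: (@le_trans _ _ (\esum_(b in [set: digit]) \esum_(d in Db b) om d)).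
  apply: le_esum => b _; apply: dyadic_content_le_cover => x [Gx sbx].
  have sx : cell s x by apply: prefix_subcube sbx; exact: prefix_rcons.
  have [d Dd dx] := GD _ (conj Gx sx); exists d => //; split => //.
  have /orP[//|] := subcube_comparable sbx dx.
  move=> /prefix_rcons_inv[->|ds]; first exact: prefix_refl.
  by move: (nD _ Dd); rewrite ds.
rewrite esum_esum; last by move=> *; exact: cost_ge0.
rewrite -(esum_image ([set: digit] `*`` Db) snd (fun d => om d)); last first.
  move=> [b d] [b' d'] /[!inE] -[_ [_ /= bd]] [_ [_ /= bd']] /= dd'.
  move: bd'; rewrite -dd' => bd'; congr (_, _).
  move: bd bd'; rewrite !prefixE !size_rcons => /eqP -> /eqP.
  by move=> /rcons_inj[].
by apply: esum_subset => _ [[b d] [_ [Dd _]] <-].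
Qed.

End DyadicContent.

(** * The selected cubes: packing and quasi-additivity *)

Lemma prefix_antisym (T : eqType) (s d : seq T) : prefix s d -> prefix d s -> s = d.
Proof.
move=> sd ds; have /eqP sz : size s == size d by rewrite eqn_leq !size_prefix.
by move: sd; rewrite prefixE sz take_size => /eqP.
Qed.

Lemma prefix_common (T : eqType) (s e d : seq T) :
  prefix s d -> prefix e d -> prefix s e || prefix e s.
Proof.
rewrite [prefix s d]prefixE [prefix e d]prefixE => /eqP <- /eqP <-.
case: (leqP (size s) (size e)) => [se|/ltnW es].
  by rewrite -[X in take X d](minn_idPl se) take_min prefix_take.
by rewrite -[X in _ || prefix (take X d) _](minn_idPl es) take_min prefix_take orbT.
Qed.

(** A finite set of words has bounded length, so bounds proved by induction on the depth pass to the
    full sum. *)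
Lemma esum_le_size {R : realType} (T : choiceType) (A : set (seq T))
    (a : seq T -> \bar R) (M : \bar R) : (forall s, 0 <= a s) ->
  (forall m, \esum_(s in A `&` [set s | (size s <= m)%N]) a s <= M) ->
  \esum_(s in A) a s <= M.
Proof.
move=> a0 AM; apply: ge_ereal_sup => _ [X [finX XA] <-].
have /finite_seqP[r rE] := finX.
apply: (le_trans _ (AM (\max_(s <- r) size s)%N)).
rewrite -(esum_fset (a := a))//; apply: esum_subset => s Xs; split; first exact: XA.
by apply: leq_bigmax_seq => //; rewrite rE in Xs.
Qed.

Section Selection.
Context {R : realType} {n : nat} (delta : R) (Q : cube R n) (G : set 'rV[R]_n).
Hypothesis delta_ge0 : (0 <= delta)%R.
Local Notation digit := {ffun 'I_n -> bool}.
Implicit Types (s d e : seq digit).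
Local Notation H := (@hcontent R n delta).
Local Notation cell s := (cube_set (subcube Q s)).
Local Notation om s := (cost delta (subcube Q s)).
Local Notation dyadic := (dyadic_content delta Q).

(** The reverse inequality always holds, so heaviness is an equality: no dyadic covering of the
    trace beats the cell itself. *)
Definition heavy s := om s <= dyadic (G `&` cell s).

Definition selected s := heavy s /\ forall d, prefix d s -> heavy d -> d = s.

Lemma heavy_selected s : heavy s -> exists2 d, prefix d s & selected d.
Proof.
have [m sm] := ubnP (size s); elim: m => // m IH in s sm * => hs.
have [ss|ns] := pselect (selected s); first by exists s => //; exact: prefix_refl.
have [d [ds hd dns]] : exists d, [/\ prefix d s, heavy d & d <> s].
  apply: contrapT => nd; apply: ns; split => // d ds hd.
  by apply: contrapT => dns; apply: nd; exists d.
have dsz : (size d < size s)%N.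
  rewrite ltn_neqAle size_prefix// andbT; apply/eqP => sz; apply: dns.
  by move: ds; rewrite prefixE sz take_size => /eqP.
have [|e ed se] := IH d _ hd; first by rewrite (leq_trans dsz).
by exists e => //; exact: prefix_trans ds.
Qed.

Lemma selected_antichain s d : selected s -> selected d -> prefix s d -> s = d.
Proof. by move=> [hs _] [_ +] sd; exact. Qed.

Lemma dyadic_cell_le E s : dyadic (E `&` cell s) <= om s.
Proof.
have := @dyadic_content_le_cover _ _ delta Q [set s] (E `&` cell s).
by rewrite esum_set1 ?cost_ge0//; apply; rewrite bigcup_set1; exact: subIsetr.
Qed.

(** Bounding by the content of the trace, rather than by the cost of [s], lets the induction pass
    through light cells by [dyadic_content_children]. At a heavy [s], the only selected word below
    is [s] itself. *)
Let packing_depth m s : (forall d, prefix d s -> heavy d -> d = s) ->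
  \esum_(d in [set d | selected d /\ prefix s d] `&`
              [set d | (size d <= size s + m)%N]) om d <=
  dyadic (G `&` cell s).
Proof.
elim: m s => [|m IH] s ms.
all: have [hs|] := boolP (om s <= dyadic (G `&` cell s)).
1,3: apply: (le_trans _ hs); apply: (@le_trans _ _ (\esum_(d in [set s]) om d)).
1,3: by apply: esum_subset => d [[[_ sd] ps] _] /=; rewrite (sd s ps hs).
1,2: by rewrite esum_set1 ?cost_ge0.
all: rewrite -ltNge => light.
  rewrite (_ : _ `&` _ = set0) ?esum_set0 ?dyadic_content_ge0//.
  apply/seteqP; split => // d [[[hd _] sd] /=]; rewrite addn0 => dsz.
  have ds : d = s.
    by move: sd; rewrite prefixE take_oversize// => /eqP.
  by move: hd; rewrite ds /heavy leNgt light.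
apply: (le_trans _ (dyadic_content_children delta_ge0 light)).
apply: (@le_trans _ _ (\esum_(d in \bigcup_(b in [set: digit])
    ([set d | selected d /\ prefix (rcons s b) d] `&`
     [set d | (size d <= size (rcons s b) + m)%N])) om d)).
  apply: esum_subset => d [[[hd sd] /prefixP[[|b u] dE]] /= dsz].
    by move: hd; rewrite dE cats0 /heavy leNgt light.
  exists b => //; split; last by rewrite /= size_rcons addSnnS.
  by split=> //; rewrite dE -cat_rcons prefix_prefix.
apply: le_trans (esum_bigcup_le _ _ _) _; first by move=> *; exact: cost_ge0.
apply: le_esum => b _; apply: IH => d /prefix_rcons_inv[//|ds] hd.
by have := ms _ ds hd => dE; move: hd; rewrite dE /heavy leNgt light.
Qed.

Lemma selected_packing s :
  \esum_(d in [set d | selected d /\ prefix s d]) om d <= om s.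
Proof.
have [ms|] := pselect (forall d, prefix d s -> heavy d -> d = s).
  apply: esum_le_size => [d|m]; first exact: cost_ge0.
  apply: (le_trans _ (dyadic_cell_le G s)); apply: (le_trans _ (packing_depth m ms)).
  apply: esum_subset => d [sd /= dm]; split => //=.
  by rewrite (leq_trans dm)// leq_addl.
(* A heavy proper prefix of [s] leaves no selected word extending [s]. *)
move=> /existsNP[e /not_implyP[es /not_implyP[he ens]]].
rewrite (_ : [set d | _] = set0) ?esum_set0 ?cost_ge0//.
apply/seteqP; split => // d [[_ sd] psd]; apply: ens.
have ed := sd e (prefix_trans es psd) he.
by apply: prefix_antisym es _; rewrite ed.
Qed.

(** A charging argument against a fixed dyadic covering [D] of [A]. If a selected [s] lies inside
    some [d] of [D], its cost is charged to [d]; otherwise the members of [D] strictly inside [s]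
    cover the trace and are charged their own cost. No [d] receives more than its cost. *)
Lemma selected_quasi_additive A :
  \esum_(s in selected) H (A `&` cell s) <= dyadic A.
Proof.
apply: le_ereal_inf_tmp => _ [D [AD ->]].
pose a s d := if prefix d s then om s else if prefix s d then om d else 0.
have a0 s d : 0 <= a s d by rewrite /a; do 2?case: ifP => _; rewrite ?cost_ge0.
apply: (@le_trans _ _ (\esum_(s in selected) \esum_(d in D) a s d)).
  apply: le_esum => s ss.
  have [[d Dd ds]|nD] := pselect (exists2 d, D d & prefix d s).
    apply: (@le_trans _ _ (a s d)); last exact: esum_ge_term.
    rewrite /a ds; apply: le_trans (le_hcontent _ (@subIsetr _ _ _)) _.
    exact: hcontent_cube_le.
  apply: (@le_trans _ _ (\esum_(d in D `&` [set d | prefix s d]) om d)).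
    apply: hcontent_le_cover => x [Ax sx]; have [d Dd dx] := AD _ Ax.
    exists d => //; split => //=.
    have /orP[//|ds] := subcube_comparable sx dx.
    by exfalso; apply: nD; exists d.
  apply: (@le_trans _ _ (\esum_(d in D `&` [set d | prefix s d]) a s d)).
    apply: le_esum => d [Dd /= sd]; rewrite /a sd; case: ifP => // ds.
    by rewrite (prefix_antisym sd ds).
  by apply: esum_subset; exact: subIsetl.
rewrite esum_exchange//; apply: le_esum => d _.
(* If [d] is strictly inside a selected [s0], the antichain property makes [s0] the only cube
   charging it. Otherwise all charges come from selected cubes inside [d], and packing bounds
   them. *)
have [[s0 [ss0 s0d ns0]]|nS] := pselect (exists s0, [/\ selected s0, prefix s0 d & s0 <> d]).
  apply: (@le_trans _ _ (\esum_(s in [set s0]) a s d)); last first.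
    rewrite esum_set1// /a s0d; case: ifP => // ds0.
    by case: ns0; exact: prefix_antisym.
  rewrite [leLHS]esum_mkcond [leRHS]esum_mkcond; apply: le_esum => s _.
  case: ifPn => [/set_mem ss|_]; last by case: ifP.
  have [->|ss0'] := eqVneq s s0; first by rewrite mem_set.
  rewrite /a; case: ifPn => [ds|_].
    by move: ss0'; rewrite (selected_antichain ss0 ss (prefix_trans s0d ds)) eqxx.
  case: ifPn => [sd|_]; last by case: ifP.
  have /orP[p|p] := prefix_common sd s0d.
    by move: ss0'; rewrite (selected_antichain ss ss0 p) eqxx.
  by move: ss0'; rewrite (selected_antichain ss0 ss p) eqxx.
apply: (@le_trans _ _ (\esum_(s in [set s | selected s /\ prefix d s]) om s)).
  rewrite [leLHS]esum_mkcond [leRHS]esum_mkcond; apply: le_esum => s _.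
  case: ifPn => [/set_mem ss|_]; last by case: ifP; rewrite ?cost_ge0.
  rewrite /a; case: ifPn => ds; first by rewrite mem_set.
  case: ifPn => [sd|_]; last by case: ifP; rewrite ?cost_ge0.
  have [sdE|/eqP nsd] := eqVneq s d; first by rewrite sdE prefix_refl in ds.
  by exfalso; apply: nS; exists s.
exact: selected_packing.
Qed.

End Selection.

(** * The Choquet integral *)

Section LebesgueScaling.
Context {R : realType}.
Local Notation mu := (@lebesgue_measure R).

(** Superlevel sets of a monotone function are intervals. This makes the layer function of a Choquet
    integral measurable for an arbitrary integrand. *)
Lemma nonincreasing_emeasurable (D : set R) (g : R -> \bar R) : measurable D ->
  {homo g : s t / (s <= t)%R >-> t <= s} -> measurable_fun D g.
Proof.
move=> mD ng; apply: (@measurable_funS _ _ _ _ setT) => //.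
apply: (measurability _ (ErealGenOInfty.measurableE R)) => //.
move=> /= _ [_ [x ->] <-]; apply: measurableI => //.
apply: is_interval_measurable => s t /=; rewrite !in_itv/= !andbT => gs gt u.
by move=> /andP[_ ut]; rewrite in_itv/= andbT (lt_le_trans gt)// ng.
Qed.

(** Both measures agree on half-open intervals, which characterizes Lebesgue measure. *)
Lemma pushforward_mulr_lebesgue (r : {nonneg R}) (A : set R) :
  (0 < r%:num)%R -> measurable A ->
  pushforward (mscale r mu) ( *%R r%:num : _ -> measurableTypeR R) A = mu A.
Proof.
move=> r0 mA; apply/esym/lebesgue_measure_unique => //= _ [[a b]] _ <-; rewrite /pushforward /mscale /=.
rewrite (_ : _ @^-1` _ = `](a / r%:num)%R, (b / r%:num)%R]%classic); last first.
  apply/seteqP; split => x /=; rewrite !in_itv/= ltr_pdivrMr// ler_pdivlMr//.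
    by rewrite mulrC.
  by rewrite mulrC.
rewrite !lebesgue_measure_itv/= !lte_fin ltr_pM2r ?invr_gt0//.
by case: ifPn => ab; rewrite ?mule0// -!EFinB -EFinM -mulrBl mulrCA divff ?gt_eqF// mulr1.
Qed.

Lemma integral_scale (g : R -> \bar R) (r : R) : (0 < r)%R ->
  (forall t, 0 <= g t) -> measurable_fun [set: R] g ->
  \int[mu]_(t in `]0%R, +oo[) g t =
  r%:E * \int[mu]_(t in `]0%R, +oo[) g (r * t)%R.
Proof.
move=> r0 g0 mg; pose r' := NngNum (ltW r0).
have mI : measurable (`]0%R, +oo[ : set R) by exact: measurable_itv.
have mgI : measurable_fun (`]0%R, +oo[ : set R) g by exact: measurable_funS mg.
have mr : measurable_fun [set: measurableTypeR R] ( *%R r : _ -> measurableTypeR R).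
  exact: mulrl_measurable.
transitivity (\int[pushforward (mscale r' mu) ( *%R r : _ -> measurableTypeR R)]_(t in `]0%R, +oo[) g t).
  apply: eq_measure_integral => A mA _; exact/esym/(@pushforward_mulr_lebesgue r').
rewrite ge0_integral_pushforward//.
have -> : *%R r @^-1` `]0%R, +oo[ = `]0%R, +oo[%classic.
  by apply/seteqP; split=> x /=; rewrite !in_itv/= !andbT pmulr_rgt0.
rewrite ge0_integral_mscale//; last by move=> *; exact: g0.
by apply: (@measurable_funS _ _ _ _ setT) => //; exact: measurableT_comp mg mr.
Qed.
End LebesgueScaling.

Section Choquet.
Context {R : realType} {n : nat} (delta : R).
Implicit Types (E F G : set 'rV[R]_n) (a b : 'rV[R]_n -> \bar R).
Local Notation mu := (@lebesgue_measure R).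
Local Notation H := (@hcontent R n delta).
Local Notation layer E a t := (H (E `&` [set x | t%:E < a x])).

Lemma measurable_layer (D : set R) E a : measurable D ->
  measurable_fun D (fun t : R => layer E a t).
Proof.
move=> mD; apply: nonincreasing_emeasurable => // s t st.
apply: le_hcontent => x [Ex /= tx]; split => //=.
by apply: le_lt_trans tx; rewrite lee_fin.
Qed.

Lemma choquet_ge0 E a : 0 <= choquet delta E a.
Proof. by apply: integral_ge0 => t _; exact: hcontent_ge0. Qed.

Lemma choquet_le_layer E F a b :
  (forall t : R, (0 < t)%R -> layer E a t <= layer F b t) ->
  choquet delta E a <= choquet delta F b.
Proof.
move=> EF; apply: ge0_le_integral => //.
- by move=> *; exact: hcontent_ge0.
- exact: measurable_layer.
- exact: measurable_layer.
- by move=> t /=; rewrite in_itv/= andbT => /EF.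
Qed.

Lemma le_choquet E F a : E `<=` F -> choquet delta E a <= choquet delta F a.
Proof.
by move=> EF; apply: choquet_le_layer => t _; apply: le_hcontent; exact: setSI.
Qed.

Lemma choquet_null E a : H E = 0 -> choquet delta E a = 0.
Proof.
move=> E0; rewrite /choquet -[RHS](integral0 mu `]0%R, +oo[).
by apply: eq_integral => t _; exact: hcontent_null_sub E0.
Qed.

Lemma choquet_esum (I : countType) (D : set I) (F : I -> set 'rV[R]_n) a :
  \esum_(i in D) choquet delta (F i) a =
  \int[mu]_(t in `]0%R, +oo[) \esum_(i in D) layer (F i) a t.
Proof.
pose g (k : nat) (t : R) := if (pickle_inv k : option I) is Some i then
  if i \in D then layer (F i) a t else 0 else 0.
rewrite esum_countable; last by move=> *; exact: choquet_ge0.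
transitivity (\int[mu]_(t in `]0%R, +oo[) \sum_(k <oo) g k t); last first.
  by apply: eq_integral => t _; rewrite esum_countable// => i; exact: hcontent_ge0.
rewrite integral_nneseries//.
- apply: eq_eseriesr => k _; rewrite /g; case: pickle_inv => [i|].
    by case: ifP => // _; rewrite integral0.
  by rewrite integral0.
- move=> k; rewrite /g; case: pickle_inv => [i|]; last exact: measurable_cst.
  by case: (i \in D); [exact: measurable_layer|exact: measurable_cst].
- by move=> k t _; rewrite /g; case: pickle_inv => [i|]; [case: ifP => // _|]; rewrite ?hcontent_ge0.
Qed.

Lemma measurable_esum_layer (I : countType) (D : set I) (F : I -> set 'rV[R]_n) a
    (A : set R) : measurable A ->
  measurable_fun A (fun t => \esum_(i in D) layer (F i) a t).
Proof.
move=> mA; apply: nonincreasing_emeasurable => // s t st.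
apply: le_esum => i _; apply: le_hcontent => x [Ex /= tx]; split => //=.
by apply: le_lt_trans tx; rewrite lee_fin.
Qed.

(** For a fixed integrand, the layers over a union are the unions of the layers, so subadditivity in
    the domain is inherited from the content. *)
Lemma choquet_bigcup (I : countType) (D : set I) (F : I -> set 'rV[R]_n) a :
  choquet delta (\bigcup_(i in D) F i) a <= \esum_(i in D) choquet delta (F i) a.
Proof.
rewrite choquet_esum; apply: ge0_le_integral => //.
- by move=> *; exact: hcontent_ge0.
- exact: measurable_layer.
- exact: measurable_esum_layer.
- by move=> t _; rewrite setI_bigcupl; exact: hcontent_bigcup.
Qed.

Lemma choquetU E F a :
  choquet delta (E `|` F) a <= choquet delta E a + choquet delta F a.
Proof.
rewrite -ge0_integralD//; last 4 first.
- by move=> *; exact: hcontent_ge0.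
- exact: measurable_layer.
- by move=> *; exact: hcontent_ge0.
- exact: measurable_layer.
apply: ge0_le_integral => //.
- by move=> *; exact: hcontent_ge0.
- exact: measurable_layer.
- by apply: emeasurable_funD; exact: measurable_layer.
- by move=> t _; rewrite setIUl; exact: hcontentU.
Qed.

(** Transfers quasi-additivity from the content to the weight: a bound valid in every layer with the
    same constant can be integrated. *)
Lemma choquet_esum_le (I : countType) (D : set I) (F : I -> set 'rV[R]_n) G a (K : R) :
  (0 <= K)%R ->
  (forall t : R, \esum_(i in D) layer (F i) a t <= K%:E * layer G a t) ->
  \esum_(i in D) choquet delta (F i) a <= K%:E * choquet delta G a.
Proof.
move=> K0 FG; rewrite choquet_esum -ge0_integralZl_EFin//; last 2 first.
- by move=> *; exact: hcontent_ge0.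
- exact: measurable_layer.
apply: ge0_le_integral => //.
- by move=> *; apply: esum_ge0 => *; exact: hcontent_ge0.
- exact: measurable_esum_layer.
- by apply: measurable_funeM; exact: measurable_layer.
Qed.

Lemma choquet_ge_cst E a (c : R) m : (0 <= c)%R -> 0 <= m ->
  (forall t : R, (0 < t < c)%R -> m <= layer E a t) ->
  c%:E * m <= choquet delta E a.
Proof.
move=> c0 m0 ma.
apply: (@le_trans _ _ (\int[mu]_(t in `]0%R, c[) layer E a t)); last first.
  apply: ge0_subset_integral => //.
  - exact: measurable_layer.
  - by move=> *; exact: hcontent_ge0.
  - by move=> t /=; rewrite !in_itv/= => /andP[->].
apply: (@le_trans _ _ (\int[mu]_(t in `]0%R, c[) cst m t)).
  rewrite integral_cst//= lebesgue_measure_itv/= lte_fin.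
  case: ltP => [_|c0']; first by rewrite sube0 muleC.
  by rewrite mule0 (_ : c = 0%R) ?mul0e//; apply/eqP; rewrite eq_le c0 c0'.
apply: ge0_le_integral => //.
- exact: measurable_layer.
Qed.

Lemma choquet_scale E F a b (r : R) : (0 < r)%R ->
  (forall t : R, (0 < t)%R -> layer E a t <= layer F b (r * t)) ->
  r%:E * choquet delta E a <= choquet delta F b.
Proof.
move=> r0 EF; rewrite [leRHS](integral_scale r0); last 2 first.
- by move=> *; exact: hcontent_ge0.
- exact: measurable_layer.
apply: lee_wpmul2l; first by rewrite lee_fin ltW.
apply: ge0_le_integral => //.
- by move=> *; exact: hcontent_ge0.
- exact: measurable_layer.
- apply: nonincreasing_emeasurable => // s t st.
  apply: le_hcontent => x [Ex /= tx]; split => //=.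
  by apply: le_lt_trans tx; rewrite lee_fin ler_pM2l.
- by move=> t /=; rewrite in_itv/= andbT => /EF.
Qed.

End Choquet.

(** * Muckenhoupt weights *)

Section Muckenhoupt.
Context {R : realType} {n : nat} (delta : R).
Implicit Types (E F G : set 'rV[R]_n) (Q : cube R n) (w : 'rV[R]_n -> \bar R).
Local Notation H := (@hcontent R n delta).

Lemma choquet_chebyshev E w (c : R) : (0 <= c)%R ->
  c%:E * H (E `&` [set x | c%:E <= w x]) <= choquet delta E w.
Proof.
move=> c0; apply: choquet_ge_cst => //; first exact: hcontent_ge0.
move=> t /andP[_ tc]; apply: le_hcontent => x [Ex /= cx]; split => //=.
by apply: lt_le_trans cx; rewrite lte_fin.
Qed.

Lemma weight_cube_lty w Q : weight delta w -> choquet delta (cube_set Q) w < +oo.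
Proof.
move=> [wloc _]; pose K : set 'rV[R]_n := [set x | forall i : 'I_n,
  `[corner Q ord0 i, (corner Q ord0 i + edge Q)%R]%classic (x ord0 i)].
have cK : compact K.
  by apply: (@rV_compact _ _ (fun i => `[corner Q ord0 i, (corner Q ord0 i + edge Q)%R]%classic)) => i;
    exact: segment_compact.
apply: le_lt_trans (wloc _ cK); apply: choquet_le_layer => t _.
apply: le_hcontent => x [Qx /= tx]; split; last exact: lt_le_trans (lee_abs _).
by move=> i; rewrite /= in_itv/=; have /andP[/ltW -> ->] := Qx i.
Qed.

(** If the integral vanished, Chebyshev would make every set where [w] is at least 1/(k+1) null in
    [Q]; these sets exhaust [Q] up to a null set. *)
Lemma weight_cube_gt0 w Q : weight delta w -> 0 < H (cube_set Q) ->
  0 < choquet delta (cube_set Q) w.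
Proof.
move=> [_ wae] HQ; rewrite lt_neqAle choquet_ge0 andbT; apply/eqP => /esym w0.
have Hk (c : R) : (0 < c)%R -> H (cube_set Q `&` [set x | c%:E <= w x]) = 0.
  move=> c0; have := choquet_chebyshev (cube_set Q) w (ltW c0).
  rewrite w0 -lee_pdivlMl// mule0 => h.
  by apply/eqP; rewrite eq_le h hcontent_ge0.
have : H (cube_set Q) <= H ([set x | ~ (0 < w x < +oo)] `|`
    \bigcup_k (cube_set Q `&` [set x | (k.+1%:R^-1)%:E <= w x])).
  apply: le_hcontent => x Qx; have [wx|] := pselect (0 < w x < +oo); last by left.
  right; move: wx => /andP[]; case E : (w x) => [u| |]// u0 _.
  exists (Num.bound u^-1) => //; split => //=; rewrite E lee_fin.
  rewrite lte_fin in u0; rewrite invf_ple ?posrE ?ltr0n//.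
  have ui0 : (0 <= u^-1)%R by rewrite invr_ge0 ltW.
  by apply: (le_trans (ltW (archi_boundP ui0))); rewrite ler_nat.
move=> /(lt_le_trans HQ); apply/negP; rewrite -leNgt; apply: le_trans (hcontentU _ _ _) _.
rewrite (_ : H [set x | ~ _] = 0) ?add0e//.
apply: le_trans (hcontent_bigcup_nat _ _) _; rewrite eseries0// => k _ _.
by apply: Hk; rewrite invr_gt0.
Qed.

(** At almost every point of [Q], [w] is at least its average W/h divided by [c], so all layers of
    [E] below that height have the full content of [E]. *)
Lemma A1_condition w (c h W gam : R) Q E : (0 < c)%R ->
  hcontent_ae delta (fun x => maximal delta w x <= c%:E * w x) ->
  H (cube_set Q) = h%:E -> (0 < h)%R ->
  choquet delta (cube_set Q) w = W%:E -> (0 < W)%R ->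
  (0 < gam)%R -> E `<=` cube_set Q -> (gam * h)%:E <= H E ->
  (W * (gam / c))%:E <= choquet delta E w.
Proof.
move=> c0 wmax Qh h0 QW W0 gam0 EQ HE.
have -> : (W * (gam / c))%:E = (W / (h * c))%:E * (gam * h)%:E.
  by rewrite -EFinM; congr EFin; field; rewrite !gt_eqF.
apply: choquet_ge_cst.
- by rewrite divr_ge0 ?mulr_ge0 ?ltW.
- by rewrite lee_fin mulr_ge0 ?ltW.
move=> t /andP[t0 tW]; apply: (le_trans HE).
apply: (@le_trans _ _ (H ((E `&` [set x | t%:E < w x]) `|`
  [set x | ~ (maximal delta w x <= c%:E * w x)]))); last first.
  by apply: le_trans (hcontentU _ _ _) _; rewrite wmax adde0.
apply: le_hcontent => x Ex.
have [mx|] := pselect (maximal delta w x <= c%:E * w x); last by right.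
left; split => //=; apply: (@lt_le_trans _ _ (W / (h * c))%:E); first by rewrite lte_fin.
rewrite invfM mulrA mulrC EFinM lee_pdivrMl//; apply: le_trans mx.
apply: le_trans (ereal_sup_ubound _); last by exists Q => //; exact: EQ.
rewrite /choquet_avg Qh inver gt_eqF// mulrC EFinM -QW.
apply: lee_wpmul2l; first by rewrite lee_fin invr_ge0 ltW.
apply: choquet_le_layer => s _; apply: le_hcontent => y [Qy /= sy].
by split => //=; exact: lt_le_trans (lee_abs _).
Qed.

(** Where [w] is at most [s], the dual weight [sigma] is large, so Chebyshev for [sigma] shows that
    this set takes at most half of the guaranteed content of [E]. Chebyshev for [w] is then applied
    to the rest. *)
Lemma Ap_condition w (p M h W gam : R) Q E : weight delta w -> (1 < p)%R ->
  (0 <= M)%R -> Ap_const delta p w <= M%:E ->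
  H (cube_set Q) = h%:E -> (0 < h)%R ->
  choquet delta (cube_set Q) w = W%:E -> (0 < W)%R ->
  (0 < gam)%R -> E `<=` cube_set Q -> (gam * h)%:E <= H E ->
  (W * ((gam / 2) `^ (p - 1) / (M + 1) * (gam / 2)))%:E <= choquet delta E w.
Proof.
move=> [_ wae] p1 M0 ApM Qh h0 QW W0 gam0 EQ HE.
have r0 : (0 < p - 1)%R by rewrite subr_gt0.
(* The value of [v] ensures M v <= (gam/2)^r, which is what [Ss] requires; [M + 1] keeps the
   denominator positive when [M] is 0. *)
set r := (p - 1)%R in r0 *; set v := ((gam / 2) `^ r / (M + 1))%R.
have v0 : (0 < v)%R by rewrite divr_gt0 ?powR_gt0 ?divr_gt0 ?ltr_wpDl.
pose sigma x := (w x `^ r^-1)^-1.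
have avgw : choquet_avg delta Q w = (W / h)%:E.
  by rewrite /choquet_avg Qh QW inver gt_eqF// -EFinM mulrC.
have avgM : (W / h)%:E * choquet_avg delta Q sigma `^ r <= M%:E.
  by apply: (le_trans _ ApM); apply: ereal_sup_ubound; exists Q => //; rewrite avgw.
have S0 : 0 <= choquet_avg delta Q sigma.
  by rewrite mule_ge0 ?choquet_ge0// Qh inver gt_eqF// lee_fin invr_ge0 ltW.
(* An infinite average of [sigma] would make the A_p product infinite, as W/h is positive. *)
have [S SE] : exists S : R, choquet_avg delta Q sigma = S%:E.
  move: avgM S0; case: choquet_avg => [S _ _| |//]; first by exists S.
  by rewrite poweRyr ?gt_eqF// gt0_muley ?lte_fin ?divr_gt0// leNgt ltry.
rewrite SE lee_fin in S0; rewrite SE poweR_EFin -EFinM lee_fin in avgM.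
have QS : choquet delta (cube_set Q) sigma = (h * S)%:E.
  by rewrite EFinM -SE /choquet_avg Qh inver gt_eqF// muleA -EFinM mulfV ?gt_eqF// mul1e.
pose s := (W / h * v)%R.
have s0 : (0 < s)%R by rewrite mulr_gt0// divr_gt0.
have Ss : (S * s `^ r^-1 <= gam / 2)%R.
  rewrite leNgt; apply/negP => lt.
  have g20 : (0 <= gam / 2)%R by rewrite divr_ge0 ?ltW.
  have := gt0_ltr_powR r0 g20 (mulr_ge0 S0 (powR_ge0 _ _)) lt.
  rewrite /= [((S * _) `^ _)%R]powRM ?powR_ge0// -powRrM mulVf ?gt_eqF// powRr1 ?ltW//.
  apply/negP; rewrite -leNgt.
  apply: (@le_trans _ _ (M * v)%R).
    by rewrite /s mulrA (ler_wpM2r (ltW v0))// mulrC.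
  by rewrite /v mulrCA ler_piMr ?powR_ge0// ler_pdivrMr ?mul1r ?lerDl// ltr_wpDl.
have H2 : H (E `&` [set x | 0 < w x <= s%:E]) <= (h * (gam / 2))%:E.
  apply: (@le_trans _ _ (h * (S * s `^ r^-1))%:E); last by rewrite lee_fin ler_pM2l.
  rewrite mulrA [leRHS]EFinM -lee_pdivrMr ?powR_gt0// muleC -QS.
  apply: (le_trans _ (choquet_chebyshev _ _ (c := (s `^ r^-1)^-1) _)); last first.
    by rewrite invr_ge0 powR_ge0.
  apply: lee_wpmul2l; first by rewrite lee_fin invr_ge0 powR_ge0.
  apply: le_hcontent => x [Ex /= /andP[w0 ws]]; split; first exact: EQ.
  rewrite /= /sigma; move: w0 ws; case: (w x) => [u| |]//.
  rewrite lte_fin lee_fin => u0 us; rewrite poweR_EFin inver gt_eqF ?powR_gt0//.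
  rewrite lee_fin lef_pV2 ?posrE ?powR_gt0//; apply: ge0_ler_powR => //.
  - by rewrite invr_ge0 ltW.
  - by rewrite nnegrE ltW.
  - by rewrite nnegrE ltW.
have H1 : (h * (gam / 2))%:E <= H (E `&` [set x | s%:E <= w x]).
  have : H E <= H ((E `&` [set x | s%:E <= w x]) `|`
      ((E `&` [set x | 0 < w x <= s%:E]) `|` [set x | ~ (0 < w x < +oo)])).
    apply: le_hcontent => x Ex.
    have [/andP[w0 _]|] := pselect (0 < w x < +oo); last by right; right.
    by have [sw|/ltW ws] := leP s%:E (w x); [left|right; left; split => //=; rewrite w0].
  move=> /(le_trans HE)/le_trans/(_ (hcontentU _ _ _)).
  move=> /le_trans/(_ (leeD2l _ (hcontentU _ _ _))).
  rewrite (_ : H [set x | ~ _] = 0)// adde0 => /le_trans/(_ (leeD2l _ H2)).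
  rewrite -leeBlDr// -EFinB => /(le_trans _); apply; rewrite lee_fin.
  by rewrite [leRHS](_ : _ = h * (gam / 2))%R//; field.
apply: (le_trans _ (choquet_chebyshev E w (ltW s0))).
apply: (@le_trans _ _ (s%:E * (h * (gam / 2))%:E)); last first.
  by apply: lee_wpmul2l H1; rewrite lee_fin ltW.
rewrite -EFinM lee_fin [leRHS](_ : _ = W * (v * (gam / 2)))%R//.
by rewrite /s; field; rewrite gt_eqF.
Qed.

Lemma muckenhoupt_cube (p gam : R) w : muckenhoupt delta p w -> (1 <= p)%R ->
  (forall Q, 0 < H (cube_set Q) < +oo) -> (0 < gam)%R ->
  exists C : R, (0 < C)%R /\ forall Q E, E `<=` cube_set Q ->
    gam%:E * H (cube_set Q) <= H E ->
    choquet delta (cube_set Q) w <= C%:E * choquet delta E w.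
Proof.
move=> [ww Mw] p1 HQ gam0.
suff [c [c0 cP]] : exists c : R, (0 < c)%R /\ forall Q E (h W : R),
    H (cube_set Q) = h%:E -> (0 < h)%R ->
    choquet delta (cube_set Q) w = W%:E -> (0 < W)%R ->
    E `<=` cube_set Q -> (gam * h)%:E <= H E ->
    (W * c)%:E <= choquet delta E w.
  exists c^-1%R; split; first by rewrite invr_gt0.
  move=> Q E EQ HE; have /andP[h0 hy] := HQ Q.
  have Wy := weight_cube_lty Q ww; have W0 := weight_cube_gt0 ww h0.
  have hE : H (cube_set Q) = (fine (H (cube_set Q)))%:E by rewrite fineK// ge0_fin_numE// ltW.
  have WE : choquet delta (cube_set Q) w = (fine (choquet delta (cube_set Q) w))%:E.
    by rewrite fineK// ge0_fin_numE// ltW.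
  rewrite WE lee_pdivlMl// muleC -EFinM; apply: (cP Q E _ _ hE _ WE) => //.
  - by rewrite -lte_fin -hE.
  - by rewrite -lte_fin -WE.
  - by rewrite EFinM -hE.
move: Mw; case: ifPn => [_ A1|pn1 Ap].
  have [_ [c [c0 cP] <-] _] := ereal_inf_lt A1.
  exists (gam / c)%R; split; first by rewrite divr_gt0.
  by move=> Q E h W *; exact: (@A1_condition w c h W gam Q E).
have [M [M0 MP]] : exists M : R, (0 <= M)%R /\ Ap_const delta p w <= M%:E.
  move: Ap; case E : Ap_const => [M| |]// _.
    by exists (Num.max M 0)%R; split; rewrite ?lee_fin le_max lexx ?orbT.
  by exists 0%R; split => //; exact: leNye.
exists ((gam / 2) `^ (p - 1) / (M + 1) * (gam / 2))%R; split.
  by rewrite mulr_gt0 ?divr_gt0 ?powR_gt0 ?ltr_wpDl ?divr_gt0.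
move=> Q E h W *; apply: (@Ap_condition w p M h W gam Q E) => //.
by rewrite lt_neqAle eq_sym pn1.
Qed.

End Muckenhoupt.

(** * Decay of the level sets *)

Section Decay.
Context {R : realType} {n : nat} (delta kappa : R).
Implicit Types (E F G : set 'rV[R]_n) (Q P : cube R n).
Local Notation digit := {ffun 'I_n -> bool}.
Implicit Types (s d : seq digit).
Local Notation H := (@hcontent R n delta).
Hypothesis delta_ge0 : (0 <= delta)%R.
Hypothesis kappa01 : (0 < kappa <= 1)%R.
Hypothesis hcontent_cube : forall Q, H (cube_set Q) = kappa%:E * cost delta Q.
Local Notation cell Q s := (cube_set (subcube Q s)).
Local Notation K := (#|{: digit}|%:R * 2 `^ delta)%R.

Let kappa_gt0 : (0 < kappa)%R. Proof. by case/andP: kappa01. Qed.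

Let card_ge1 : (1 <= #|{: digit}|%:R :> R)%R.
Proof. by rewrite ler1n; apply/card_gt0P; exists [ffun=> true]. Qed.

Let K_gt0 : (0 < K)%R.
Proof. by rewrite mulr_gt0 ?powR_gt0// (lt_le_trans ltr01). Qed.

Let hcube_gt0 Q : 0 < H (cube_set Q).
Proof. by rewrite hcontent_cube mule_gt0 ?cost_gt0// lte_fin. Qed.

Let hcube_lty Q : H (cube_set Q) < +oo.
Proof. by rewrite hcontent_cube /cost -EFinM ltry. Qed.

(** A density bound in every dyadic cell is summed over an arbitrary dyadic covering. *)
Lemma hcontent_le_dyadic_scaled E Q (g : R) : (0 < g)%R ->
  (forall s, H (E `&` cell Q s) <= g%:E * cost delta (subcube Q s)) ->
  H E <= g%:E * dyadic_content delta Q E.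
Proof.
move=> g0 Eg; rewrite -lee_pdivrMl//; apply: le_ereal_inf_tmp => _ [D [ED ->]].
rewrite lee_pdivrMl// -esum_pZl//; last by move=> *; exact: cost_ge0.
apply: (@le_trans _ _ (H (\bigcup_(s in D) (E `&` cell Q s)))).
  by apply: le_hcontent => x Ex; have [s Ds sx] := ED _ Ex; exists s.
by apply: le_trans (hcontent_bigcup _ _ _) _; apply: le_esum => s _.
Qed.

(** Any set has content at most [kappa] times the cost in each cell, hence at most [kappa] times its
    dyadic content. If [G] filled a light cell up to a null set, the content of the cell would be
    strictly below [kappa] times its cost, its exact value. *)
Lemma light_gt0 Q G s : ~ heavy delta Q G s -> 0 < H (cell Q s `\` G).
Proof.
move=> /negP; rewrite -ltNge => light.
rewrite lt_neqAle hcontent_ge0 andbT; apply/eqP => /esym H0.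
have : H (cell Q s) <= H (cell Q s `\` G) + H (G `&` cell Q s).
  apply: le_trans (hcontentU _ _ _); apply: le_hcontent => x sx.
  by have [Gx|nGx] := pselect (G x); [right|left].
rewrite H0 add0e; apply/negP; rewrite -ltNge.
apply: (@le_lt_trans _ _ (kappa%:E * dyadic_content delta Q (G `&` cell Q s))).
  apply: hcontent_le_dyadic_scaled => // d; rewrite -hcontent_cube.
  by apply: le_hcontent => x [].
rewrite hcontent_cube lte_pmul2l ?lte_fin//.
Qed.

Lemma essinf_le Q (f : 'rV[R]_n -> R) (v : R) :
  0 < H (cube_set Q `&` [set x | (f x <= v)%R]) -> essinf delta Q f <= v%:E.
Proof.
move=> Hv; apply/lee_addgt0Pr => e e0; apply: ereal_inf_lbound.
exists (v + e)%R => //=; apply: (lt_le_trans Hv); apply: le_hcontent => x [Qx /= xv].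
by split => //=; rewrite (le_lt_trans xv)// ltrDl.
Qed.

Section Step.
Variables (w : 'rV[R]_n -> \bar R) (f : 'rV[R]_n -> R) (m : cube R n -> R) (A : R).
Hypothesis essinfE : forall Q, essinf delta Q f = (m Q)%:E.
Local Notation level Q u := (cube_set Q `&` [set x | (m Q + u < f x)%R]).
Local Notation gam := ((2 * K)^-1)%R.
Hypothesis small : forall P, H (level P A) < gam%:E * H (cube_set P).
Variable Q : cube R n.
Local Notation G := (level Q A).

Let gam_gt0 : (0 < gam)%R. Proof. by rewrite invr_gt0 mulr_gt0. Qed.

(** Excluding the root guarantees that every selected cube has a parent inside [Q]. *)
Let root_light : ~ heavy delta Q G [::].
Proof.
rewrite /heavy/=; apply/negP; rewrite -ltNge.
apply: le_lt_trans (dyadic_content_le _ _) _; [exact: delta_ge0|by move=> x []..|].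
have GQ : G `&` cube_set Q `<=` level Q A by move=> x [].
apply: (@le_lt_trans _ _ (K%:E * H (level Q A))).
  by apply: lee_wpmul2l; [rewrite lee_fin ltW|exact: le_hcontent].
apply: (@lt_le_trans _ _ (K%:E * (gam%:E * H (cube_set Q)))).
  by rewrite lte_pmul2l ?lte_fin// small.
apply: (@le_trans _ _ (H (cube_set Q))); last exact: hcontent_cube_le.
rewrite muleA -EFinM -[leRHS]mul1e; apply: lee_wpmul2r; first exact: hcontent_ge0.
by rewrite lee_fin invfM mulrCA mulfV ?gt_eqF// mulr1 invf_le1// ler1n.
Qed.

Let cell_sub s : cell Q s `<=` cube_set Q.
Proof. exact: (@prefix_subcube _ _ Q [::] s (prefix0s s)). Qed.

Let light_level s : ~ heavy delta Q G s -> (m (subcube Q s) <= m Q + A)%R.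
Proof.
move=> /light_gt0 H0; rewrite -lee_fin -essinfE; apply: essinf_le.
apply: (lt_le_trans H0); apply: le_hcontent => x [sx nGx]; split => //=.
by rewrite leNgt; apply/negP => fx; apply: nGx; split => //; exact: cell_sub sx.
Qed.

(** The parent is light by maximality, so its infimum is at most m Q + A. The part of the parent
    above its own level [A] has too little content to fill the child up to a null set. *)
Let selected_level s : selected delta Q G s -> (m (subcube Q s) <= m Q + A + A)%R.
Proof.
case/lastP: s => [[]//|s b [hs sel]].
have ls : ~ heavy delta Q G s.
  move=> /(sel _ (prefix_rcons _ _))/(congr1 size)/eqP.
  by rewrite size_rcons ltn_eqF.
apply: (@le_trans _ _ (m (subcube Q s) + A)%R); last by rewrite lerD2r light_level.
rewrite -lee_fin -essinfE; apply: essinf_le.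
rewrite lt_neqAle hcontent_ge0 andbT; apply/eqP => /esym H0.
have : H (cell Q (rcons s b)) <= H (level (subcube Q s) A).
  apply: (@le_trans _ _ (H ((cell Q (rcons s b) `&`
      [set x | (f x <= m (subcube Q s) + A)%R]) `|` level (subcube Q s) A))).
    apply: le_hcontent => x sx; have [fx|fx] := leP (f x) (m (subcube Q s) + A)%R; first by left.
    by right; split => //; apply: prefix_subcube sx; exact: prefix_rcons.
  by apply: le_trans (hcontentU _ _ _) _; rewrite H0 add0e.
apply/negP; rewrite -ltNge; apply: (lt_le_trans (small _)).
(* The factor 2^delta in [K] absorbs the ratio between the costs of parent and child. *)
rewrite !hcontent_cube muleCA lee_pmul2l ?lte_fin// /cost !edge_subcube size_rcons.
rewrite -EFinM lee_fin exprS [((2 * _ ^+ _)^-1)%R]invfM [(edge Q * (_ * _))%R]mulrCA.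
have e0 : (0 < edge Q / 2 ^+ size s)%R by rewrite divr_gt0 ?edge_gt0 ?exprn_gt0.
rewrite [leRHS]powRM ?(ltW e0) ?invr_ge0//; apply: ler_wpM2r; first exact: powR_ge0.
have -> : ((2^-1 : R) `^ delta = (2 `^ delta)^-1)%R.
  by rewrite -powR_inv1// -powRrM mulN1r powRN.
rewrite lef_pV2 ?posrE ?powR_gt0//; last by rewrite mulr_gt0.
rewrite mulrA -[leLHS]mul1r ler_wpM2r ?powR_ge0//.
by rewrite -[leLHS]mul1r ler_pM// ler1n.
Qed.

Let rest := [set x | [/\ cube_set Q x, (m Q + A + A < f x)%R &
  forall s, selected delta Q G s -> ~ cell Q s x]].

Let rest_null : H rest = 0.
Proof.
have restQ : rest `<=` cube_set Q by move=> x [].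
have Hfin : H rest \is a fin_num.
  by rewrite ge0_fin_numE ?hcontent_ge0// (le_lt_trans (le_hcontent _ restQ)).
have : H rest <= gam%:E * dyadic_content delta Q rest.
  apply: hcontent_le_dyadic_scaled => // s.
  (* A heavy cell lies in a selected one and so misses [rest]; in a light cell P, [rest] lies above
     m P + A. *)
  have [hs|ls] := pselect (heavy delta Q G s).
    rewrite (_ : _ `&` _ = set0) ?hcontent0 ?mule_ge0 ?cost_ge0 ?lee_fin ?ltW//.
    apply/seteqP; split => // x [[_ _ nsel] sx].
    have [d ds sel] := heavy_selected hs.
    by apply: (nsel d sel); exact: prefix_subcube sx.
  apply: (@le_trans _ _ (H (level (subcube Q s) A))).
    apply: le_hcontent => x [[_ fx _] sx]; split => //=.
    by apply: le_lt_trans fx; rewrite lerD2r light_level.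
  apply: (le_trans (ltW (small _))); apply: lee_wpmul2l; first by rewrite lee_fin ltW.
  exact: hcontent_cube_le.
(* Since gam K = 1/2, the finite content of [rest] is at most half of itself. *)
move=> /le_trans/(_ (lee_wpmul2l _ (dyadic_content_le delta_ge0 restQ))).
rewrite -(fineK Hfin) -!EFinM !lee_fin => /(_ (ltW gam_gt0)).
have := hcontent_ge0 delta rest; rewrite -(fineK Hfin) lee_fin => h0.
rewrite invfM mulrA -[(2^-1 / _ * K)%R]mulrA mulVf ?gt_eqF// mulr1 => h.
congr EFin; lra.
Qed.

(** The constant collects [q] from the level bound on each selected cube P, [C] from replacing P by
    its trace of [G], which has at least 1/K of its content, and [K] from summing the traces. *)
Lemma level_step (u q C : R) : (0 <= u)%R -> (0 < q)%R -> (0 < C)%R ->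
  (forall P E, E `<=` cube_set P -> (K^-1)%:E * H (cube_set P) <= H E ->
     choquet delta (cube_set P) w <= C%:E * choquet delta E w) ->
  (forall P, choquet delta (level P u) w <= q%:E * choquet delta (cube_set P) w) ->
  choquet delta (level Q (u + (A + A))) w <= (q * C * K)%:E * choquet delta (level Q A) w.
Proof.
move=> u0 q0 C0 wC lev.
have -> : (q * C * K)%:E * choquet delta G w = (q * C)%:E * (K%:E * choquet delta G w).
  by rewrite muleA -EFinM.
apply: (@le_trans _ _ (choquet delta (rest `|`
   \bigcup_(s in selected delta Q G) level (subcube Q s) u) w)).
  apply: le_choquet => x [Qx /= fx].
  have [[s ss sx]|nsel] := pselect (exists2 s, selected delta Q G s & cell Q s x).
    right; exists s => //; split => //=; apply: le_lt_trans fx.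
    by rewrite [(u + _)%R]addrC addrA lerD2r addrA selected_level.
  left; split => //; first by apply: le_lt_trans fx; rewrite -addrA lerD2l lerDr.
  by move=> s ss sx; apply: nsel; exists s.
apply: le_trans (choquetU _ _ _ _) _; rewrite choquet_null ?add0e//.
apply: le_trans (choquet_bigcup _ _ _ _) _.
apply: (@le_trans _ _ (\esum_(s in selected delta Q G)
    ((q * C)%:E * choquet delta (G `&` cell Q s) w))).
  apply: le_esum => s [hs _]; apply: (le_trans (lev _)).
  rewrite EFinM -muleA; apply: lee_wpmul2l; first by rewrite lee_fin ltW.
  apply: wC; first exact: subIsetr.
  rewrite lee_pdivrMl//; apply: (le_trans (hcontent_cube_le _ _)); apply: (le_trans hs).
  by apply: dyadic_content_le => // x [_]; exact: cell_sub.
rewrite esum_pZl ?mulr_gt0//; last by move=> *; exact: choquet_ge0.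
apply: lee_wpmul2l; first by rewrite lee_fin mulr_ge0 ?ltW.
(* The selection depends on [G] alone, but quasi-additivity holds for every set, hence for each
   layer of [w] in [G]. *)
apply: choquet_esum_le => [|t]; first exact: ltW.
apply: (@le_trans _ _ (dyadic_content delta Q (G `&` [set x | t%:E < w x]))); last first.
  by apply: dyadic_content_le => // x [[]].
apply: (le_trans _ (selected_quasi_additive Q G delta_ge0 _)).
by apply: le_esum => s _; rewrite setIAC.
Qed.

End Step.
End Decay.

(** * Iteration of the halving step, and consequences of a finite BLO norm *)

Section LevelDecay.
Context {R : realType} {n : nat} (delta kappa : R).
Implicit Types (E F G : set 'rV[R]_n) (Q P : cube R n).
Local Notation H := (@hcontent R n delta).
Hypothesis delta_ge0 : (0 <= delta)%R.
Hypothesis kappa01 : (0 < kappa <= 1)%R.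
Hypothesis hcontent_cube : forall Q, H (cube_set Q) = kappa%:E * cost delta Q.
Variable w : 'rV[R]_n -> \bar R.
Local Notation W E := (choquet delta E w).
Hypothesis ww : weight delta w.

Let hcube_gt0 Q : 0 < H (cube_set Q).
Proof.
case/andP: kappa01 => k0 _.
by rewrite hcontent_cube mule_gt0 ?cost_gt0// lte_fin.
Qed.

Lemma level_decay :
  (forall gam : R, (0 < gam)%R -> exists C : R, (0 < C)%R /\
    forall Q E, E `<=` cube_set Q -> gam%:E * H (cube_set Q) <= H E ->
    W (cube_set Q) <= C%:E * W E) ->
  exists eps : R, (0 < eps)%R /\
    forall (f : 'rV[R]_n -> R) (m : cube R n -> R) (A : R), (0 < A)%R ->
    (forall Q, essinf delta Q f = (m Q)%:E) ->
    (forall Q, W (cube_set Q `&` [set x | (m Q + A < f x)%R]) <=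
       eps%:E * W (cube_set Q)) ->
    forall j Q, W (cube_set Q `&` [set x | (m Q + (A + A) *+ j < f x)%R]) <=
      (2^-1 ^+ j)%:E * W (cube_set Q).
Proof.
set K := (#|{: {ffun 'I_n -> bool}}|%:R * 2 `^ delta)%R => wC.
have K0 : (0 < K)%R.
  by rewrite mulr_gt0 ?powR_gt0// ltr0n; apply/card_gt0P; exists [ffun=> true].
have [|C1 [C10 wC1]] := wC (2 * K)^-1%R; first by rewrite invr_gt0 mulr_gt0.
have [|C2 [C20 wC2]] := wC K^-1%R; first by rewrite invr_gt0.
(* This [eps] meets two demands: C1 eps < 1 yields the density bound [small], and C2 K eps <= 1/2
   yields the halving. *)
exists (2 * (C1 + C2 * K))^-1%R.
have D0 : (0 < 2 * (C1 + C2 * K))%R by rewrite mulr_gt0// addr_gt0// mulr_gt0.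
split=> [|f m A A0 fm fA]; first by rewrite invr_gt0.
(* Otherwise W(P) <= C1 eps W(P) < W(P), which is absurd because W(P) is positive and finite. *)
have small P : H (cube_set P `&` [set x | (m P + A < f x)%R]) <
    ((2 * K)^-1)%:E * H (cube_set P).
  rewrite ltNge; apply/negP => /wC1 h.
  have := le_trans (h (@subIsetl _ _ _)) (lee_wpmul2l _ (fA P)).
  rewrite lee_fin => /(_ (ltW C10)); apply/negP; rewrite -ltNge muleA -EFinM.
  have W0 := weight_cube_gt0 ww (hcube_gt0 P).
  have Wf : W (cube_set P) \is a fin_num.
    by rewrite ge0_fin_numE ?choquet_ge0// weight_cube_lty.
  rewrite -[ltRHS]mul1e lte_pmul2r// lte_fin ltr_pdivrMr// mul1r.
  by have := mulr_gt0 C20 K0; lra.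
elim=> [|j IH] Q.
  by rewrite expr0 mul1e le_choquet.
rewrite mulrSr; apply: le_trans.
  apply: (@level_step _ _ _ _ delta_ge0 kappa01 hcontent_cube w f m A fm small Q _ _ C2 _ _ C20 wC2 IH).
  by rewrite mulrn_wge0// addr_ge0 ?ltW.
  by rewrite exprn_gt0.
apply: le_trans (lee_wpmul2l _ (fA Q)) _.
  by rewrite lee_fin mulr_ge0 ?(ltW K0)// mulr_ge0 ?(ltW C20)// exprn_ge0.
rewrite muleA -EFinM; apply: lee_wpmul2r; first exact: choquet_ge0.
have half (a b : R) : (0 < a)%R -> (0 < b)%R -> (b / (2 * (a + b)) <= 2^-1)%R.
  move=> a0 b0; rewrite ler_pdivrMr ?mulr_gt0 ?addr_gt0// mulKf ?gt_eqF//.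
  by rewrite lerDr ltW.
rewrite lee_fin exprSr -[X in (X * _ <= _)%R]mulrA -[leLHS]mulrA.
apply: ler_wpM2l; first by rewrite exprn_ge0.
by apply: half => //; exact: mulr_gt0.
Qed.

(** As [f] is real-valued, [Q] is the union of the sets where f < k; an infimum of [+oo] would make
    all of them null. *)
Lemma essinf_neq_pinfty f Q : essinf delta Q f != +oo.
Proof.
apply/eqP => /ereal_inf_pinfty Ey.
have H0 (t : R) : H (cube_set Q `&` [set x | (f x < t)%R]) = 0.
  apply/eqP; rewrite eq_le hcontent_ge0 andbT leNgt; apply/negP => Ht.
  by have /Ey : [set t%:E | t in [set t : R |
    0 < H (cube_set Q `&` [set x | (f x < t)%R])]] t%:E by exists t.
have : H (cube_set Q) <= H (\bigcup_k (cube_set Q `&` [set x | (f x < k%:R)%R])).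
  apply: le_hcontent => x Qx; exists (Num.bound `|f x|) => //; split => //=.
  by apply: (le_lt_trans (ler_norm _)); apply: archi_boundP.
move=> /(lt_le_trans (hcube_gt0 Q)); apply/negP; rewrite -leNgt.
apply: le_trans (hcontent_bigcup_nat _ _) _; rewrite eseries0// => k _ _; exact: H0.
Qed.

Lemma BLO_norm_ge0 q f : 0 <= BLO_norm delta q w f.
Proof.
apply: le_trans (ereal_sup_ubound _); last by exists (Cube 0 (@ltr01 R)).
exact: poweR_ge0.
Qed.

Lemma BLO_oscillation q f Q (N : R) : (0 < q)%R -> (0 <= N)%R ->
  BLO_norm delta q w f <= N%:E ->
  choquet delta (cube_set Q)
    (fun x => `|(f x)%:E - essinf delta Q f| `^ q * w x) <=
  (N `^ q)%:E * W (cube_set Q).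
Proof.
move=> q0 N0 fN.
set I := choquet _ _ _.
have W0 := weight_cube_gt0 ww (hcube_gt0 Q).
have WE : (fine (W (cube_set Q)))%:E = W (cube_set Q).
  by rewrite fineK// ge0_fin_numE ?choquet_ge0// weight_cube_lty.
have v0 : (0 < fine (W (cube_set Q)))%R by rewrite -lte_fin WE.
have : ((W (cube_set Q))^-1 * I) `^ q^-1 <= N%:E.
  by apply: le_trans fN; apply: ereal_sup_ubound; exists Q.
have I0 : 0 <= I by exact: choquet_ge0.
rewrite -WE inver gt_eqF//; move: I0; case: I => [I|_|//].
  rewrite lee_fin => I0; rewrite -EFinM poweR_EFin lee_fin => IN.
  rewrite -EFinM lee_fin -ler_pdivrMr// mulrC.
  have := ge0_ler_powR (ltW q0) _ _ IN.
  rewrite !nnegrE powR_ge0 N0 => /(_ isT isT) /=.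
  rewrite -powRrM mulVf ?gt_eqF// powRr1// mulr_ge0// invr_ge0 ltW//.
by rewrite gt0_muley ?lte_fin ?invr_gt0// poweRyr ?gt_eqF ?invr_gt0.
Qed.

(** With infimum [-oo] the integrand is [+oo] almost everywhere, so every layer has at least the
    content of [Q] and the oscillation integral is infinite. *)
Lemma essinf_neq_ninfty q f Q : (0 < q)%R ->
  BLO_norm delta q w f < +oo -> essinf delta Q f != -oo.
Proof.
move=> q0 fN; apply/eqP => Ey.
have Nf : BLO_norm delta q w f = (fine (BLO_norm delta q w f))%:E.
  by rewrite fineK// ge0_fin_numE ?BLO_norm_ge0.
have := @BLO_oscillation q f Q (fine (BLO_norm delta q w f)) q0 _ _.
rewrite fine_ge0 ?BLO_norm_ge0// -Nf => /(_ isT (lexx _)); apply/negP.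
rewrite -ltNge; apply: (@lt_le_trans _ _ +oo).
  by rewrite lte_mul_pinfty ?lee_fin ?powR_ge0// weight_cube_lty.
rewrite leye_eq; apply/eqP/eqyP => c c0.
set I := choquet _ _ _.
have HQ := hcube_gt0 Q.
have HE : (fine (H (cube_set Q)))%:E = H (cube_set Q).
  by rewrite fineK// hcontent_cube /cost -EFinM.
have v0 : (0 < fine (H (cube_set Q)))%R by rewrite -lte_fin HE.
have -> : c%:E = (c / fine (H (cube_set Q)))%:E * H (cube_set Q).
  by rewrite -HE -EFinM divfK ?gt_eqF.
apply: choquet_ge_cst; [by rewrite divr_ge0 ?ltW|exact: ltW|move=> t _].
have [_ wae] := ww.
apply: (@le_trans _ _ (H ((cube_set Q `&` [set x | t%:E <
   `|(f x)%:E - essinf delta Q f| `^ q * w x]) `|` [set x | ~ (0 < w x < +oo)]))).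
  apply: le_hcontent => x Qx; have [/andP[w0 _]|] := pselect (0 < w x < +oo); last by right.
  by left; split => //=; rewrite Ey (_ : `|(f x)%:E - -oo| = +oo)// poweRyr ?gt_eqF// gt0_mulye// ltry.
by apply: le_trans (hcontentU _ _ _) _; rewrite [X in _ + X <= _]wae adde0.
Qed.

(** Chebyshev for the weighted oscillation: on the level set the integrand is at least A^q w, and
    [choquet_scale] extracts the factor A^q. *)
Lemma BLO_level q f Q (m A N : R) : (0 < q)%R -> (0 < A)%R -> (0 < N)%R ->
  BLO_norm delta q w f <= N%:E -> essinf delta Q f = m%:E ->
  W (cube_set Q `&` [set x | (m + A < f x)%R]) <=
  ((N / A) `^ q)%:E * W (cube_set Q).
Proof.
move=> q0 A0 N0 fN mE; have := @BLO_oscillation q f Q N q0 (ltW N0) fN.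
rewrite mE => fW.
have Aq : (0 < A `^ q)%R by rewrite powR_gt0.
rewrite (_ : ((N / A) `^ q)%R = (A `^ q)^-1 * N `^ q)%R; last first.
  rewrite mulrC powRM ?invr_ge0 ?ltW//.
  by rewrite -powR_inv1 ?ltW// -powRrM mulN1r powRN.
rewrite EFinM -muleA lee_pdivlMl//; apply: le_trans fW.
apply: choquet_scale => // t t0; apply: le_hcontent => x [[Qx /= mf] tw].
split => //=; rewrite EFinM.
have fA : (A `^ q <= `|f x - m| `^ q)%R.
  apply: ge0_ler_powR; rewrite ?nnegrE ?(ltW q0) ?(ltW A0)//.
  by rewrite (le_trans _ (ler_norm _))// lerBrDl ltW.
apply: (@lt_le_trans _ _ ((A `^ q)%:E * w x)); first by rewrite lte_pmul2l.
apply: lee_wpmul2r; last by rewrite lee_fin.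
by rewrite (le_trans _ (ltW tw))// lee_fin ltW.
Qed.

End LevelDecay.

(** * From halving at integer steps to exponential decay *)

Theorem proposition1p14 (R : realType) (n : nat) (delta p q : R)
    (w : 'rV[R]_n -> \bar R)
    (hdelta : (0 < delta <= n%:R)%R) (hp : (1 <= p)%R) (hq : (0 < q)%R)
    (hw : muckenhoupt delta p w) :
  exists c C : R, (0 < c)%R /\ (0 < C)%R /\
    forall (Q : cube R n) (t : R) (f : 'rV[R]_n -> R),
      (0 < t)%R -> BLO delta q w f -> BLO_norm delta q w f != 0 ->
      choquet delta
        (cube_set Q `&` [set x | t%:E < (f x)%:E - essinf delta Q f]) w
      <= C%:E * choquet delta (cube_set Q) w *
         (expR (- (c * t / fine (BLO_norm delta q w f))))%:E.
Proof.
have delta_ge0 : (0 <= delta)%R by case/andP: hdelta => /ltW.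
have [k [/andP[k0 k1] Hk]] := @hcontent_cubeE R n delta.
(* If cubes had content 0, both sides would vanish; so the positivity of the
   content of a cube need not be proved. *)
have [k00|kn0] := eqVneq k 0%R.
  exists 1%R, 1%R; do 2![split => //] => Q t f _ _ _.
  rewrite choquet_null; first by rewrite !mule_ge0 ?choquet_ge0// lee_fin expR_ge0.
  apply: (@hcontent_null_sub _ _ _ _ (cube_set Q)); first exact: subIsetl.
  by rewrite Hk k00 mul0e.
have {k0} k01 : (0 < k <= 1)%R by rewrite lt_neqAle eq_sym kn0 k0.
have [ww _] := hw.
have Hcube (Q : cube R n) : 0 < hcontent delta (cube_set Q) < +oo.
  case/andP: k01 => k0 _; rewrite Hk /cost -EFinM ltry lte_fin mulr_gt0//.
  by rewrite powR_gt0// edge_gt0.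
have [eps [eps0 decay]] := level_decay delta_ge0 k01 Hk ww
  (fun gam gam0 => muckenhoupt_cube hw hp Hcube gam0).
(* With A = lam N, the Chebyshev factor (N/A)^q equals exactly [eps]. *)
pose lam := (eps^-1 `^ q^-1)%R.
have lam0 : (0 < lam)%R by rewrite powR_gt0// invr_gt0.
(* Each rise of the level by 2A = 2 lam N halves the weight, hence the rate ln 2 / (2 lam). The
   factor 2 pays for rounding t / (2A) down to an integer. *)
exists (ln 2 / (lam + lam))%R, 2%R; split; last split => //.
  by rewrite divr_gt0 ?ln_gt0 ?ltr1n// addr_gt0.
move=> Q t f t0 [_ fN] fn0.
set N := fine _.
have NE : BLO_norm delta q w f = N%:E.
  by rewrite fineK// ge0_fin_numE ?BLO_norm_ge0.
have N0 : (0 < N)%R.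
  by rewrite -lte_fin -NE lt_neqAle eq_sym fn0 BLO_norm_ge0.
pose m P := fine (essinf delta P f).
have mE P : essinf delta P f = (m P)%:E.
  rewrite fineK// fin_numE (essinf_neq_pinfty k01 Hk) andbT.
  exact: (essinf_neq_ninfty k01 Hk ww P hq fN).
pose A := (lam * N)%R.
have A0 : (0 < A)%R by rewrite mulr_gt0.
have small P : choquet delta (cube_set P `&` [set x | (m P + A < f x)%R]) w <=
    eps%:E * choquet delta (cube_set P) w.
  have := BLO_level k01 Hk ww hq A0 N0 _ (mE P); rewrite NE => /(_ (lexx _)).
  rewrite /A invfM mulrCA mulfV ?gt_eqF// mulr1 /lam -powRN -powRrM.
  by rewrite mulNr mulVf ?gt_eqF// powR_inv1 ?invrK// invr_ge0 ltW.
pose j := Num.trunc (t / (A + A)).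
have AA0 : (0 < A + A)%R by rewrite addr_gt0.
have /andP[jt tj] : (j%:R <= t / (A + A) < j.+1%:R)%R.
  by apply: trunc_itv; rewrite divr_ge0 ?ltW.
apply: (@le_trans _ _ ((2^-1 ^+ j)%:E * choquet delta (cube_set Q) w)).
  apply: le_trans (decay f m A A0 mE small j Q).
  apply: le_choquet => x [Qx /=]; rewrite mE -EFinB lte_fin => tx; split => //=.
  rewrite addrC -ltrBrDr; apply: le_lt_trans tx.
  by rewrite -mulr_natl -ler_pdivlMr.
rewrite [leRHS]muleAC -EFinM; apply: lee_wpmul2r; first exact: choquet_ge0.
rewrite lee_fin.
have ln20 : (0 < ln 2 :> R)%R by rewrite ln_gt0// ltr1n.
(* Passing to the exponent j + 1 allows the use of t / (2A) < j + 1. *)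
have -> : (2^-1 ^+ j = 2 * expR (j.+1%:R * - ln 2) :> R)%R.
  by rewrite expRM_natl expRN lnK ?posrE// exprS mulrA mulfV ?gt_eqF// mul1r.
rewrite ler_pM2l// ler_expR mulrN lerN2.
rewrite [leLHS](_ : _ = t / (A + A) * ln 2)%R; first by rewrite ler_wpM2r ?ltW.
by rewrite /A; field; rewrite !gt_eqF// addr_gt0 ?mulr_gt0.
Qed.
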